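(* Let $0\le\alpha<1$. For every Schwartz function $f\in\mathbb S(\mathbb R)$, the special affine Fourier transform $\widehat f_{\Lambda_S}$ satisfies $$|B|^{\alpha}\int_{\mathbb R}|\omega|^{-\alpha}\big|\widehat f_{\Lambda_S}(\omega)\big|^2\,d\omega\le C_\alpha\int_{\mathbb R}|x|^{\alpha}|f(x)|^2\,dx,\qquad C_\alpha=\pi^{\alpha}\left[\Gamma\left(\frac{1-\alpha}{4}\right)\Big/\Gamma\left(\frac{1+\alpha}{4}\right)\right]^2,$$ where $\Gamma$ is Euler's gamma function.
   Context: Fix real parameters $A,B,C,D,p,q$ with $AD-BC=1$ and $B\neq0$ (collected in $\Lambda_S$). $z^*$ denotes the complex conjugate of $z$. Put $K_B=\frac1{\sqrt{2\pi B}}$ (principal square root) and $$\mathcal K_{\Lambda_S}(x,\omega)=K_B^*\exp\left\{\frac{i}{2B}\big(Ax^2+2x(p-\omega)-2\omega(Dp-Bq)+D\omega^2\big)\right\}.$$ The special affine Fourier transform (SAFT) of a Schwartz function $f$ is $\widehat f_{\Lambda_S}(\omega)=\int_{\mathbb R}f(x)\mathcal K_{\Lambda_S}(x,\omega)\,dx$. *)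

(* Defs.v *)
From HB Require Import structures.
From mathcomp Require Import all_boot all_order all_algebra.
From mathcomp Require Import all_classical all_reals all_analysis.
From mathcomp Require Import complex.

Set Implicit Arguments.
Unset Strict Implicit.
Unset Printing Implicit Defensive.

Import Order.TTheory GRing.Theory Num.Theory.
Import numFieldNormedType.Exports.

Local Open Scope classical_set_scope.
Local Open Scope ring_scope.
Local Open Scope complex_scope.

Section Defs.
Variable R : realType.
Implicit Types (f g : R -> R[i]) (z : R[i]).

Local Notation mu := (@lebesgue_measure R).
Local Notation Re := (@complex.Re R).
Local Notation Im := (@complex.Im R).

(* The n-th derivative of a function R -> C and its integral over R are taken
   componentwise. Both operators are total: they are only meaningful when both
   components are n times differentiable, respectively integrable. *)
Definition cderiven (n : nat) f (x : R) : R[i] :=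
  derive1n n (Re \o f) x +i* derive1n n (Im \o f) x.

Definition cintegral f : R[i] :=
  (\int[mu]_x Re (f x)) +i* (\int[mu]_x Im (f x)).

Definition smooth f : Prop :=
  forall (n : nat) (x : R),
    derivable (derive1n n (Re \o f)) x 1 /\
    derivable (derive1n n (Im \o f)) x 1.

Definition schwartz f : Prop :=
  smooth f /\
  forall m n : nat, exists M : R, forall x : R,
    `|x| ^+ m * Normc.normc (cderiven n f x) <= M.

Definition cexp z : R[i] :=
  (expR (Re z))%:C * (cos (Im z) +i* sin (Im z)).

(* Euler's integral; it converges, and so defines Gamma, for 0 < s. *)
Definition Gamma (s : R) : R :=
  \int[mu]_(t in `]0, +oo[) (t `^ (s - 1) * expR (- t)).

(* [sqrtc] is the principal square root, also on the negative real axis, where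
   sqrtc (- r) = 'i * sqrtc r for 0 < r; B may be negative. *)
Definition saft_const (B : R) : R[i] := (sqrtc (2 * pi * B)%:C)^-1.

(* The entry C of the parameter matrix does not occur in the kernel. *)
Definition saft_kernel (A B D p q x omega : R) : R[i] :=
  conjc (saft_const B) *
  cexp ('i%C / (2 * B)%:C *
        (A * x ^+ 2 + 2 * x * (p - omega) - 2 * omega * (D * p - B * q)
         + D * omega ^+ 2)%:C).

Definition saft (A B D p q : R) f (omega : R) : R[i] :=
  cintegral (fun x => f x * saft_kernel A B D p q x omega).

Definition pitt_const (alpha : R) : R :=
  pi `^ alpha * (Gamma ((1 - alpha) / 4) / Gamma ((1 + alpha) / 4)) ^+ 2.

End Defs.

(* Main.v *)
(* Up to unimodular factors the transform is a Fourier transform, dilated by B,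
   of a chirped f. Writing the power of the frequency as a superposition of
   Gaussians, the left-hand side becomes a superposition of energies
   int exp (- t w^2) |F f w|^2 dw. By the Fourier transform of the Gaussian,
   each is at most int int |f x| |f y| G_t (x - y) dx dy for the heat kernel G_t.
   The inequality |f x| |f y| <= (|f x|^2 p y / p x + |f y|^2 p x / p y) / 2 with
   p y = |y|^(- (1 + alpha) / 2), itself a superposition of heat kernels, then
   gives Pitt's inequality with the sharp constant
   2^(- alpha) (Gamma ((1 - alpha) / 4) / Gamma ((1 + alpha) / 4))^2, because
   G_v * G_w = G_(v + w) turns the double superposition into a Beta integral.
   The stated constant is larger by the factor (2 pi)^alpha. For alpha = 0 the
   weight is p = 1 and t tends to 0. *)
Require Import Defs.
From HB Require Import structures.
From mathcomp Require Import all_boot all_order all_algebra.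
From mathcomp Require Import all_classical all_reals all_analysis.
From mathcomp Require Import measurable_realfun complex ring lra.

Set Implicit Arguments.
Unset Strict Implicit.
Unset Printing Implicit Defensive.

Import Order.TTheory GRing.Theory Num.Theory.
Import numFieldNormedType.Exports.

Local Open Scope classical_set_scope.
Local Open Scope ring_scope.
Local Open Scope complex_scope.

(** * Scaling, Tonelli and one-sided powers *)

Section Integration.
Variable R : realType.
Local Notation mu := (@lebesgue_measure R).
Local Open Scope ereal_scope.

(** Expanding the squared modulus of the transform gives a triple integral in x, y and w, which
    converges absolutely only under an integrable weight in w. This is why every energy carries a
    Gaussian. Oscillation enters once, through the cosine transform of that Gaussian; afterwards all
    integrands are nonnegative, and Tonelli applies to extended real integrals without any
    finiteness check. The superposition of the G_t with density t^(alpha / 2 - 1) is a multiple of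
    |z|^(alpha - 1). For a Schur weight |y|^(- s) with alpha < s < 1, its potential is a multiple of
    |x|^(alpha - s), so each such s gives the right power |x|^alpha. The constant is symmetric under
    s -> 1 + alpha - s; the fixed point s = (1 + alpha) / 2 makes its two Gamma ratios coincide,
    whence the square. *)

Lemma ge0_integral_scale (l : R) (f : R -> \bar R) : (0 < l)%R ->
  measurable_fun [set: R] f -> (forall x, 0 <= f x) ->
  \int[mu]_x f (l * x)%R = l^-1%:E * \int[mu]_x f x.
Proof.
move=> l0 mf f0.
have ml : measurable_fun [set: measurableTypeR R]
    (fun x => l * x : measurableTypeR R)%R.
  by apply: measurable_funM.
have lV0 : (0 <= l^-1)%R by rewrite invr_ge0 ltW.
(* [l] times the image measure gives every half-open interval its length, so it is Lebesgue measure
   by uniqueness. *)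
have [nu nuE] : exists nu : {measure set (measurableTypeR R) -> \bar R},
    forall A, nu A = l%:E * pushforward mu
      (fun x => l * x : measurableTypeR R)%R A.
  unshelve eexists (mscale (NngNum (ltW l0))
    (pushforward mu (fun x => l * x : measurableTypeR R)%R)); first exact: ml.
  by [].
have scale_mu A : measurable A ->
    pushforward mu (fun x => l * x : measurableTypeR R)%R A =
    mscale (NngNum lV0) mu A.
  move=> mA.
  have -> : mscale (NngNum lV0) mu A = l^-1%:E * nu A.
    rewrite /mscale/=; congr (_ * _).
    apply: (lebesgue_measure_unique (mu := nu)) => // _ [[a b]] _ <-.
    rewrite nuE /pushforward/=.
    have -> : (fun x => l * x)%R @^-1` `]a, b] =
        `](l^-1 * a)%R, (l^-1 * b)%R]%classic.
      apply/seteqP; split => x /=; rewrite !in_itv/=;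
      by rewrite ltr_pdivrMl// ler_pdivlMl.
    rewrite !lebesgue_measure_itv/= !lte_fin ltr_pM2l ?invr_gt0//.
    case: ifP => _; last by rewrite mule0.
    by rewrite -!EFinD -EFinM -mulrBr mulVKf// gt_eqF.
  by rewrite nuE muleA -EFinM mulVf ?mul1e// gt_eqF.
transitivity (\int[pushforward mu (fun x => l * x : measurableTypeR R)%R]_x f x).
  by rewrite ge0_integral_pushforward// => x _; exact: f0.
rewrite (eq_measure_integral (mscale (NngNum lV0) mu))//; last first.
  by move=> A mA _; exact: scale_mu.
by rewrite ge0_integral_mscale.
Qed.

Lemma ge0_integral_swap (F : R -> R -> \bar R) :
  measurable_fun [set: R * R] (fun z => F z.1 z.2) ->
  (forall x y, 0 <= F x y) ->
  \int[mu]_x \int[mu]_y F x y = \int[mu]_y \int[mu]_x F x y.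
Proof.
move=> mF F0; exact: (@fubini_tonelli _ _ (measurableTypeR R)
  (measurableTypeR R) R mu mu (fun z => F z.1 z.2)).
Qed.

Lemma measurable_fun_ge0_integral d (T : measurableType d)
    (F : T -> R -> \bar R) :
  measurable_fun [set: T * R] (fun z => F z.1 z.2) ->
  (forall x y, 0 <= F x y) ->
  measurable_fun [set: T] (fun x => \int[mu]_y F x y).
Proof.
move=> mF F0.
exact: (@measurable_fun_fubini_tonelli_F _ _ T
  (measurableTypeR R) R mu (fun z => F z.1 z.2)).
Qed.

Lemma ge0_integralMl (k : R) (f : R -> \bar R) : (0 <= k)%R ->
  measurable_fun [set: R] f -> (forall x, 0 <= f x) ->
  \int[mu]_x (k%:E * f x) = k%:E * \int[mu]_x f x.
Proof. by move=> k0 mf f0; exact: ge0_integralZl_EFin. Qed.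

(** The Mellin density, cut off at 0 so that integrals over the half-line become integrals over all
    of R. The shift by 1 makes [powpos s] homogeneous of degree - s together with dt; [powpos 0] is
    the Haar density dt/t. *)
Definition powpos (s t : R) : R := if (0 < t)%R then (t `^ (s - 1))%R else 0%R.

Lemma powpos_ge0 s t : (0 <= powpos s t)%R.
Proof. by rewrite /powpos; case: ifP => // _; exact: powR_ge0. Qed.

Lemma measurable_powpos s : measurable_fun [set: R] (powpos s).
Proof.
rewrite /powpos; apply: measurable_fun_ifT => //.
exact: measurable_fun_ltr.
Qed.

Lemma powposM s (l t : R) : (0 < l)%R ->
  powpos s (l * t) = (l `^ (s - 1) * powpos s t)%R.
Proof.
move=> l0; rewrite /powpos pmulr_rgt0//; case: ifPn => t0.
  by rewrite powRM// ltW.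
by rewrite mulr0.
Qed.

Lemma powpos_mul a b t : (powpos a t * powpos b t = powpos (a + b - 1) t)%R.
Proof.
rewrite /powpos; case: ifPn => t0; last by rewrite !mulr0.
rewrite -powRD ?(gt_eqF t0) ?implybT//.
by congr powR; ring.
Qed.

Lemma powposV s t : (powpos s t^-1 = powpos (2 - s) t)%R.
Proof.
rewrite /powpos invr_gt0; case: ifPn => // t0.
rewrite -{1}(@powR_inv1 _ t) ?ltW// -powRrM; congr powR; ring.
Qed.

Lemma integral_powpos_scale s (l : R) (f : R -> \bar R) : (0 < l)%R ->
  measurable_fun [set: R] f -> (forall x, 0 <= f x) ->
  \int[mu]_x ((powpos s x)%:E * f (l * x)%R) =
  (l `^ (- s))%:E * \int[mu]_x ((powpos s x)%:E * f x).
Proof.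
move=> l0 mf f0.
have mg : measurable_fun [set: R] (fun x => (powpos s x)%:E * f x).
  apply: emeasurable_funM => //; apply/measurable_EFinP.
  exact: measurable_powpos.
have g0 x : 0 <= (powpos s x)%:E * f x by rewrite mule_ge0// lee_fin powpos_ge0.
transitivity (\int[mu]_x ((l `^ (1 - s))%:E *
    ((powpos s (l * x))%:E * f (l * x)%R))).
  apply: eq_integral => x _; rewrite powposM// muleA -EFinM mulrA.
  rewrite -powRD ?(gt_eqF l0) ?implybT//.
  by rewrite (_ : (1 - s + (s - 1) = 0)%R) ?powRr0 ?mul1r//; ring.
rewrite ge0_integralMl; [|exact: powR_ge0| |by move=> x; exact: g0]; last first.
  by apply: (measurableT_comp mg); exact: measurable_funM.
rewrite (@ge0_integral_scale l (fun x => (powpos s x)%:E * f x))//.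
rewrite muleA -EFinM; congr (_%:E * _).
rewrite -powR_inv1 ?ltW// -powRD ?(gt_eqF l0) ?implybT//.
by congr powR; ring.
Qed.

(* The density of the centered normal law of variance [v / 2], for [0 < v]. *)
Definition heat (v z : R) : R :=
  ((pi * v) `^ (- 2^-1) * expR (- (z ^+ 2 * v `^ (-1))))%R.

End Integration.

(** * Finiteness and positivity of the Gamma integral on ]0, 1] *)

Section GammaFunction.
Variable R : realType.
Local Notation mu := (@lebesgue_measure R).
Local Open Scope ereal_scope.

Lemma integral_itvV1_powR_le (s : R) (n : nat) : (0 < s)%R ->
  \int[mu]_(t in `[n.+2%:R^-1%R, 1%R]) (t `^ (s - 1))%:E <= (s^-1)%:E.
Proof.
(* The power may be singular at 0, so the fundamental theorem is applied away from it. Starting at n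
   + 2 keeps the interval nondegenerate for n = 0. *)
move=> s0; set a : R := (n.+2%:R^-1)%R.
have a0 : (0 < a)%R by rewrite invr_gt0.
have a1 : (a < 1)%R by rewrite invf_lt1// ltr1n.
have dF (x : R) : (0 < x)%R ->
    is_derive x 1%R (fun t : R => s^-1 * t `^ s)%R (x `^ (s - 1))%R.
  move=> x0; have := is_deriveZ s^-1%R (is_derive1_powR s x0).
  by rewrite /GRing.scale/= mulKf// gt_eqF.
have cp (r x : R) : (0 < x)%R -> {for x, continuous (fun t : R => t `^ r)%R}.
  move=> x0; apply/differentiable_continuous/derivable1_diffP.
  by apply: derivable_powR; rewrite in_itv/= x0.
rewrite (@continuous_FTC2 _ _ (fun t => s^-1 * t `^ s)%R)//.
- rewrite powR1 mulr1 -EFinB lee_fin lerBlDr lerDl mulr_ge0 ?powR_ge0//.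
  by rewrite invr_ge0 ltW.
- apply: derivable_within_continuous => x; rewrite in_itv/= => /andP[ax _].
  by apply: derivable_powR; rewrite in_itv/= andbT (lt_le_trans a0).
- have cF x : (0 < x)%R -> {for x, continuous (fun t : R => s^-1 * t `^ s)%R}.
    by move=> x0; apply: cvgM; [exact: cvg_cst|exact: cp].
  split.
  + move=> x; rewrite in_itv/= => /andP[ax _].
    by have [] := dF _ (lt_trans a0 ax).
  + by apply: cvg_at_right_filter; exact: cF.
  + by apply: cvg_at_left_filter; exact: cF.
- move=> x; rewrite in_itv/= => /andP[ax _]; rewrite derive1E.
  by have [_] := dF _ (lt_trans a0 ax).
Qed.

Lemma integral01_powR_le (s : R) : (0 < s)%R ->
  \int[mu]_(t in `]0%R, 1%R]) (t `^ (s - 1))%:E <= (s^-1)%:E.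
Proof.
move=> s0.
have -> : `]0%R, 1%R]%classic = \bigcup_n `[(n.+2%:R^-1)%R, 1%R]%classic :> set R.
  apply/seteqP; split => [x|x [n _]] /=; rewrite !in_itv/= => /andP[x0 x1].
    have [n _ /(_ n (leqnn n))nx] := near_infty_natSinv_lt (PosNum x0).
    exists n => //=; rewrite in_itv/= x1 andbT (le_trans _ (ltW nx))//.
    by rewrite lef_pV2 ?posrE// ler_nat.
  by rewrite x1 andbT (lt_le_trans _ x0).
have mp : measurable_fun [set: R] (fun t : R => (t `^ (s - 1))%:E).
  by apply/measurable_EFinP; exact: measurable_powR.
pose I (n : nat) : set (measurableTypeR R) := `[(n.+2%:R^-1)%R, 1%R]%classic.
have ndI : nondecreasing_seq I.
  apply/nondecreasing_seqP => n; apply/subsetPset => x /=.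
  rewrite /I/= !in_itv/= => /andP[nx ->]; rewrite andbT (le_trans _ nx)//.
  by rewrite lef_pV2 ?posrE// ler_nat.
have mI n : measurable (I n) by rewrite /I; exact: measurable_itv.
have mpI n : measurable_fun (I n) (fun t : R => (t `^ (s - 1))%:E).
  exact: measurable_funTS.
have p0 n x : I n x -> 0 <= (x `^ (s - 1))%:E by rewrite lee_fin powR_ge0.
have /cvg_lim <- // :=
  @ge0_nondecreasing_set_cvg_integral _ _ _ _ _ mu ndI mI mpI p0.
apply: lime_le.
  apply: ereal_nondecreasing_is_cvgn.
  exact: ge0_nondecreasing_set_nondecreasing_integral ndI mI mpI p0.
by apply: nearW => n; exact: integral_itvV1_powR_le.
Qed.

Lemma measurable_powposE s :
  measurable_fun [set: R] (fun t : R => (powpos s t)%:E).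
Proof. by apply/measurable_EFinP; exact: measurable_powpos. Qed.

Lemma measurable_expRN : measurable_fun [set: R] (fun t : R => (expR (- t))%:E).
Proof. by apply/measurable_EFinP; apply: measurableT_comp. Qed.

(** For s <= 1 the power is at most 1 beyond t = 1, so the integrand is below t^(s - 1) on ]0, 1]
    and below the exponential density afterwards. All Gamma values of the proof have their argument
    in ]0, 1]. *)
Lemma integral_powpos_expRN_lty (s : R) : (0 < s <= 1)%R ->
  \int[mu]_t ((powpos s t)%:E * (expR (- t))%:E) < +oo.
Proof.
move=> /andP[s0 s1].
pose A (t : R) := ((fun t : R => (t `^ (s - 1))%:E) \_ `]0%R, 1%R]) t.
pose E (t : R) := (exponential_pdf 1 t)%:E.
have mA : measurable_fun [set: R] A.
  apply/(measurable_restrictT _ _).1 => //.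
  by apply: measurable_funTS; apply/measurable_EFinP; exact: measurable_powR.
have mE : measurable_fun [set: R] E.
  by apply/measurable_EFinP; exact: measurable_exponential_pdf.
have A0 t : 0 <= A t.
  by rewrite /A patchE; case: ifPn => // _; rewrite lee_fin powR_ge0.
have E0 t : 0 <= E t by rewrite lee_fin exponential_pdf_ge0.
apply: (@le_lt_trans _ _ (\int[mu]_t (A t + E t))); last first.
  rewrite ge0_integralD// /A -integral_mkcond integral_exponential_pdf//.
  apply: lte_add_pinfty; last exact: ltry.
  by apply: le_lt_trans (integral01_powR_le s0) _; exact: ltry.
apply: ge0_le_integral => //.
- by move=> t _; rewrite -EFinM lee_fin mulr_ge0 ?powpos_ge0 ?expR_ge0.
- by apply: emeasurable_funM; [exact: measurable_powposE|exact: measurable_expRN].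
- exact: emeasurable_funD.
- move=> t _; rewrite /powpos; case: ifPn => t0; last first.
    by rewrite mul0e adde_ge0.
  rewrite /E exponential_pdfE ?(ltW t0)//= mul1r mulN1r.
  have [t1|] := boolP (t <= 1)%R; last rewrite -ltNge => t1.
    rewrite /A patchE mem_set/=; last by rewrite in_itv/= t0 t1.
    rewrite -EFinM -EFinD lee_fin -[leLHS]addr0 lerD ?expR_ge0//.
    by rewrite ler_piMr ?powR_ge0// -expR0 ler_expR oppr_le0 ltW.
  rewrite -[leLHS]add0e leeD// -EFinM lee_fin ler_piMl ?expR_ge0//.
  by rewrite -[leRHS](powRr0 t) ler_powR ?(ltW t1)// subr_le0.
Qed.

Lemma Gamma_powpos s :
  Gamma s = fine (\int[mu]_t ((powpos s t)%:E * (expR (- t))%:E)).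
Proof.
rewrite /Gamma /Rintegral; congr fine; rewrite integral_mkcond.
apply: eq_integral => t _; rewrite patchE /powpos.
case: ifPn; first by rewrite inE/= in_itv/= andbT => ->; rewrite EFinM.
by rewrite notin_setE/= in_itv/= andbT => /negP/negbTE ->; rewrite mul0e.
Qed.

Lemma integral_powpos_expRN (s : R) : (0 < s <= 1)%R ->
  \int[mu]_t ((powpos s t)%:E * (expR (- t))%:E) = (Gamma s)%:E.
Proof.
move=> s01; rewrite Gamma_powpos fineK// ge0_fin_numE.
  exact: integral_powpos_expRN_lty.
apply: integral_ge0 => t _.
by rewrite -EFinM lee_fin mulr_ge0 ?powpos_ge0 ?expR_ge0.
Qed.

Lemma Gamma_gt0 (s : R) : (0 < s <= 1)%R -> (0 < Gamma s)%R.
Proof.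
move=> /[dup] /andP[s0 s1] s01; rewrite -lte_fin -integral_powpos_expRN//.
have m1 : measurable_fun [set: R]
    (fun t : R => (powpos s t)%:E * (expR (- t))%:E).
  by apply: emeasurable_funM; [exact: measurable_powposE|exact: measurable_expRN].
apply: (@lt_le_trans _ _
    (\int[mu]_(t in `]0%R, 1%R]) ((powpos s t)%:E * (expR (- t))%:E))); last first.
  apply: ge0_subset_integral => // t _.
  by rewrite -EFinM lee_fin mulr_ge0 ?powpos_ge0 ?expR_ge0.
apply: (@lt_le_trans _ _ (\int[mu]_(t in `]0%R, 1%R]) (cst (expR (- 1)%R)%:E t))).
  rewrite integral_cst//= lebesgue_measure_itv/= lte01 oppr0 adde0 mule1.
  by rewrite lte_fin expR_gt0.
apply: ge0_le_integral => //.
- by move=> t _; rewrite lee_fin expR_ge0.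
- exact: measurable_funTS.
- move=> t /=; rewrite in_itv/= /powpos => /andP[t0 t1]; rewrite t0.
  rewrite -EFinM lee_fin -[leLHS]mul1r ler_pM ?expR_ge0//.
    by rewrite -[leLHS](powRr0 t) ger_powR ?t0 ?t1// subr_le0.
  by rewrite ler_expR lerN2.
Qed.

Lemma integral_powpos_expRM (s l : R) : (0 < s <= 1)%R -> (0 < l)%R ->
  \int[mu]_t ((powpos s t)%:E * (expR (- (l * t)))%:E) =
  (Gamma s * l `^ (- s))%:E.
Proof.
move=> s01 l0.
rewrite (@integral_powpos_scale _ s l (fun t => (expR (- t))%:E))//.
  by rewrite integral_powpos_expRN// -EFinM mulrC.
exact: measurable_expRN.
Qed.

End GammaFunction.

(** * Measurability of composite expressions *)

Lemma measurable_cos (R : realType) : measurable_fun [set: R] (@cos R).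
Proof. exact: continuous_measurable_fun (@continuous_cos R). Qed.

Lemma measurable_sin (R : realType) : measurable_fun [set: R] (@sin R).
Proof. exact: continuous_measurable_fun (@continuous_sin R). Qed.

(* [measurable_fun] is a product type, so that [apply:] would try to unfold it;
   the steps below always give the exact number of arguments. *)
Ltac measurability_step := first [
  match goal with |- measurable_fun _ (fun x => ?c) =>
    refine (@measurable_cst _ _ _ _ _ c) end |
  match goal with H : measurable_fun _ ?f |- measurable_fun _ ?g =>
    constr_eq f g; exact H end |
  match goal with
  | H : measurable_fun _ ?k |- measurable_fun _ (fun x => ?h (@?f x)) =>
    constr_eq h k; refine (@measurableT_comp _ _ _ _ _ _ _ _ f H _) end |
  lazymatch goal with
  | |- measurable_fun _ (fun x => x) => refine (@measurable_id _ _ _)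
  | |- measurable_fun _ fst => exact: measurable_fst
  | |- measurable_fun _ snd => exact: measurable_snd
  | |- measurable_fun _ (fun x => EFin (@?f x)) =>
      refine (proj2 (@measurable_EFinP _ _ _ _ f) _)
  | |- measurable_fun _ (fun x => (@?f x * @?g x)%E) =>
      refine (@emeasurable_funM _ _ _ _ f g _ _)
  | |- measurable_fun _ (fun x => (@?f x + @?g x)%E) =>
      refine (@emeasurable_funD _ _ _ _ f g _ _)
  | |- measurable_fun _ (fun x => @?f x * @?g x) =>
      refine (@measurable_funM _ _ _ _ f g _ _)
  | |- measurable_fun _ (fun x => @?f x + - @?g x) =>
      refine (@measurable_funB _ _ _ _ f g _ _)
  | |- measurable_fun _ (fun x => @?f x + @?g x) =>
      refine (@measurable_funD _ _ _ _ f g _ _)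
  | |- measurable_fun _ (fun x => - @?f x) =>
      refine (@measurableT_comp _ _ _ _ _ _ _ _ f (@oppr_measurable _ _) _)
  | |- measurable_fun _ (fun x => @?f x ^+ _) =>
      refine (@measurable_funX _ _ _ _ f _ _)
  | |- measurable_fun _ (fun x => expR (@?f x)) =>
      refine (@measurableT_comp _ _ _ _ _ _ _ _ f (@measurable_expR _) _)
  | |- measurable_fun _ (fun x => powR (@?f x) _) =>
      refine (@measurableT_comp _ _ _ _ _ _ _ _ f (@measurable_powR _ _) _)
  | |- measurable_fun _ (fun x => powpos _ (@?f x)) =>
      refine (@measurableT_comp _ _ _ _ _ _ _ _ f (measurable_powpos _) _)
  | |- measurable_fun _ (fun x => heat (@?f x) (@?g x)) => unfold heat
  | |- measurable_fun _ (fun x => `| @?f x |) =>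
      refine (@measurableT_comp _ _ _ _ _ _ _ _ f (@normr_measurable _ _) _)
  | |- measurable_fun _ (fun x => cos (@?f x)) =>
      refine (@measurableT_comp _ _ _ _ _ _ _ _ f (@measurable_cos _) _)
  | |- measurable_fun _ (fun x => sin (@?f x)) =>
      refine (@measurableT_comp _ _ _ _ _ _ _ _ f (@measurable_sin _) _)
  | |- measurable_fun _ (fun x => fst x) => exact: measurable_fst
  | |- measurable_fun _ (fun x => snd x) => exact: measurable_snd
  end ].
Ltac measurability := repeat (measurability_step; cbv beta).

(** * Inversion of the Haar measure and the Beta integral *)

Section Beta.
Variable R : realType.
Local Notation mu := (@lebesgue_measure R).
Local Open Scope ereal_scope.

Let powposE_ge0 s t : 0 <= (powpos s t : R)%:E.
Proof. by rewrite lee_fin powpos_ge0. Qed.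

Let expRE_ge0 t : 0 <= (expR t : R)%:E.
Proof. by rewrite lee_fin expR_ge0. Qed.

Lemma mulEFin_injr (k : R) (x y : \bar R) : (0 < k)%R ->
  x * k%:E = y * k%:E -> x = y.
Proof.
move=> k0 xy; have kV : k%:E * (k^-1)%:E = 1 by rewrite -EFinM mulfV ?gt_eqF.
by rewrite -(mule1 x) -(mule1 y) -kV !muleA xy.
Qed.

Lemma ge0_integralMr (k : \bar R) (f : R -> \bar R) : 0 <= k ->
  measurable_fun [set: R] f -> (forall x, 0 <= f x) ->
  \int[mu]_x (f x * k) = \int[mu]_x f x * k.
Proof. by move=> k0 mf f0; exact: ge0_integralZr. Qed.

Lemma powpos_eq0 s (x : R) : (x <= 0)%R -> powpos s x = 0%R.
Proof. by move=> x0; rewrite /powpos ltNge x0. Qed.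

(* The Haar measure dx/x of the multiplicative group is invariant under
   inversion because it is invariant under scaling: test against an auxiliary
   function psi of finite nonzero integral. *)
Lemma integral_powpos_inv (f : R -> \bar R) :
  measurable_fun [set: R] f -> (forall x, 0 <= f x) ->
  \int[mu]_x ((powpos 0 x)%:E * f (x `^ (-1))%R) =
  \int[mu]_x ((powpos 0 x)%:E * f x).
Proof.
move=> mf f0.
(* Against dx/x this integrates to Gamma 1, which is positive and finite and can therefore be
   cancelled in the extended reals. *)
pose psi (x : R) := (powpos 2 x * expR (- x))%:E.
have psi0 x : 0 <= psi x by rewrite lee_fin mulr_ge0 ?powpos_ge0 ?expR_ge0.
have mpsi : measurable_fun [set: R] psi by rewrite /psi; measurability.
have Ipsi : \int[mu]_x ((powpos 0 x)%:E * psi x) = (Gamma 1)%:E.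
  rewrite -integral_powpos_expRN ?ltr01 ?lexx//; apply: eq_integral => x _.
  rewrite /psi -!EFinM mulrA powpos_mul; congr ((powpos _ _ * _)%:E).
  by ring.
have scale0 (l : R) (h : R -> \bar R) : (0 < l)%R -> measurable_fun [set: R] h ->
    (forall x, 0 <= h x) ->
    \int[mu]_x ((powpos 0 x)%:E * h x) =
    \int[mu]_x ((powpos 0 x)%:E * h (l * x)%R).
  by move=> l0 mh h0; rewrite integral_powpos_scale// oppr0 powRr0 mul1e.
have G1 : (0 < Gamma (1 : R))%R by rewrite Gamma_gt0// ltr01 lexx.
apply: (mulEFin_injr G1); rewrite -Ipsi.
have Ipsi0 : 0 <= \int[mu]_x ((powpos 0 x)%:E * psi x).
  by apply: integral_ge0 => x _; rewrite mule_ge0.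
(* Both sides times the integral of [psi], with the inner variable rescaled by Haar invariance. For
   fixed y, the substitution x -> y x in [K] yields psi (x y) f (1 / x), which is the integrand of
   [H]. *)
pose H x y := (powpos 0 x)%:E * f (x `^ (-1))%R * ((powpos 0 y)%:E * psi (x * y)%R).
pose K x y := (powpos 0 x)%:E * psi x * ((powpos 0 y)%:E * f (x `^ (-1) * y)%R).
have mH : measurable_fun [set: R * R] (fun z => H z.1 z.2).
  by rewrite /H; measurability.
have mK : measurable_fun [set: R * R] (fun z => K z.1 z.2).
  by rewrite /K; measurability.
have H0 x y : 0 <= H x y by rewrite !mule_ge0.
have K0 x y : 0 <= K x y by rewrite !mule_ge0.
rewrite -ge0_integralMr//; last 2 first.
- by measurability.
- by move=> x; rewrite mule_ge0.
rewrite [RHS]muleC -ge0_integralMr; last 3 first.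
- by apply: integral_ge0 => x _; rewrite mule_ge0.
- by measurability.
- by move=> x; rewrite mule_ge0.
transitivity (\int[mu]_x \int[mu]_y H x y).
  apply: eq_integral => x _; have [x0|x0] := ltP 0%R x; last first.
    rewrite (powpos_eq0 _ x0) !mul0e; apply/esym/integral0_eq => y _.
    by rewrite /H powpos_eq0// !mul0e.
  rewrite (scale0 _ _ x0 mpsi psi0) /H.
  rewrite muleC -ge0_integralMr; last 3 first.
  - by rewrite mule_ge0.
  - by measurability.
  - by move=> y; rewrite mule_ge0.
  by apply: eq_integral => y _; rewrite muleC.
transitivity (\int[mu]_x \int[mu]_y K x y); last first.
  apply: eq_integral => x _; have [x0|x0] := ltP 0%R x; last first.
    rewrite (powpos_eq0 _ x0) !mul0e; apply: integral0_eq => y _.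
    by rewrite /K powpos_eq0// !mul0e.
  rewrite (scale0 _ _ (powR_gt0 (-1) x0) mf f0) /K.
  rewrite [RHS]muleC -ge0_integralMr; last 3 first.
  - by rewrite mule_ge0.
  - by measurability.
  - by move=> y; rewrite mule_ge0.
  by apply: eq_integral => y _; rewrite muleC.
transitivity (\int[mu]_y \int[mu]_x H x y).
  exact: (@ge0_integral_swap R H mH H0).
transitivity (\int[mu]_y \int[mu]_x K x y); last first.
  by apply/esym; exact: (@ge0_integral_swap R K mK K0).
apply: eq_integral => y _; have [y0|y0] := ltP 0%R y; last first.
  by rewrite !integral0_eq => [//|x _|x _];
    rewrite /H /K (powpos_eq0 _ y0) !mul0e !mule0.
rewrite /K; under [RHS]eq_integral do rewrite -muleA.
rewrite (scale0 y (fun x => psi x * ((powpos 0 y)%:E * f (x `^ (-1) * y)%R)))//.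
- apply: eq_integral => x _; rewrite /H; have [x0|x0] := ltP 0%R x; last first.
    by rewrite powpos_eq0// !mul0e.
  rewrite -muleA; congr (_ * _).
  rewrite [LHS]muleCA [RHS]muleCA; congr (_ * _).
  rewrite [LHS]muleC (mulrC x); congr (_ * f _).
  by rewrite powRM ?(ltW x0) ?(ltW y0)// mulrAC (powR_inv1 (ltW y0))
     mulVf ?mul1r ?gt_eqF.
- by measurability.
- by move=> x; rewrite !mule_ge0.
Qed.

(** The substitution w = v r followed by scaling in v splits off a factor [b] that does not depend
    on f. This Beta integral is identified by testing with f u = exp (- u), for which the left-hand
    side factors into two Gamma integrals. *)
Lemma integral_powpos_add (a c : R) (f : R -> \bar R) :
  (0 < a)%R -> (0 < c)%R -> (a + c <= 1)%R ->
  measurable_fun [set: R] f -> (forall x, 0 <= f x) ->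
  \int[mu]_v \int[mu]_w ((powpos a v)%:E * (powpos c w)%:E * f (v + w)%R) =
  (Gamma a * Gamma c / Gamma (a + c))%:E *
    \int[mu]_u ((powpos (a + c) u)%:E * f u).
Proof.
move=> a0 c0 ac1 mf f0.
pose b := \int[mu]_r (powpos c r * (1 + r) `^ (- (a + c)))%:E.
have factor (h : R -> \bar R) : measurable_fun [set: R] h -> (forall x, 0 <= h x) ->
    \int[mu]_v \int[mu]_w ((powpos a v)%:E * (powpos c w)%:E * h (v + w)%R) =
    b * \int[mu]_u ((powpos (a + c) u)%:E * h u).
  move=> mh h0.
  pose F v r := (powpos (a + c) v)%:E * (powpos c r)%:E * h ((1 + r) * v)%R.
  have F0 v r : 0 <= F v r by rewrite !mule_ge0.
  have mF : measurable_fun [set: R * R] (fun z => F z.1 z.2).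
    by rewrite /F; measurability.
  transitivity (\int[mu]_v \int[mu]_r F v r).
    apply: eq_integral => v _.
    have [v0|v0] := ltP 0%R v; last first.
      by rewrite !integral0_eq => [//|w _|w _]; rewrite /F powpos_eq0// !mul0e.
    under eq_integral do rewrite -muleA.
    rewrite ge0_integralMl; last 3 first.
    - exact: powpos_ge0.
    - by measurability.
    - by move=> w; rewrite mule_ge0.
    transitivity ((powpos (a + c) v)%:E *
        \int[mu]_r ((powpos c r)%:E * h (v + v * r)%R)).
      rewrite (@integral_powpos_scale R c v (fun w => h (v + w)%R)); last 3 first.
      + exact: v0.
      + by measurability.
      + by [].
      rewrite [RHS]muleA -EFinM; congr (_%:E * _).
      by rewrite /powpos v0 -powRD ?(gt_eqF v0) ?implybT//; congr powR; ring.
    rewrite -ge0_integralMl; last 3 first.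
    - exact: powpos_ge0.
    - by measurability.
    - by move=> w; rewrite mule_ge0.
    apply: eq_integral => r _; rewrite /F muleA.
    by rewrite (_ : v + v * r = (1 + r) * v)%R//; ring.
  rewrite (@ge0_integral_swap R F mF F0).
  transitivity (\int[mu]_r ((powpos c r * (1 + r) `^ (- (a + c)))%:E *
      \int[mu]_u ((powpos (a + c) u)%:E * h u))).
    apply: eq_integral => r _; rewrite /F.
    have [r0|r0] := ltP 0%R r; last first.
      rewrite (powpos_eq0 _ r0) mul0r mul0e; apply: integral0_eq => w _.
      by rewrite mule0 mul0e.
    under eq_integral do rewrite (muleC (powpos (a + c) _)%:E) -muleA.
    rewrite ge0_integralMl; last 3 first.
    - exact: powpos_ge0.
    - by measurability.
    - by move=> w; rewrite mule_ge0.
    by rewrite (integral_powpos_scale _ _ mh h0) ?addr_gt0// EFinM muleA.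
  rewrite ge0_integralMr//.
  - by apply: integral_ge0 => u _; rewrite mule_ge0.
  - by measurability.
  - by move=> r; rewrite lee_fin mulr_ge0 ?powpos_ge0 ?powR_ge0.
have a01 : (0 < a <= 1)%R by rewrite a0/=; apply: le_trans ac1; rewrite lerDl ltW.
have c01 : (0 < c <= 1)%R by rewrite c0/=; apply: le_trans ac1; rewrite lerDr ltW.
have Gac : (0 < Gamma (a + c))%R by rewrite Gamma_gt0// addr_gt0.
rewrite (factor f mf f0); congr (_ * _).
have := factor (fun u => (expR (- u))%:E) (@measurable_expRN R)
  (fun u => expRE_ge0 _).
rewrite integral_powpos_expRN ?addr_gt0// => bE.
have {}bE : b * (Gamma (a + c))%:E = (Gamma a * Gamma c)%:E.
  rewrite -bE.
  transitivity (\int[mu]_v ((Gamma c)%:E * ((powpos a v)%:E * (expR (- v))%:E))).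
    apply: eq_integral => v _.
    rewrite -(integral_powpos_expRN c01) muleC -ge0_integralMl.
    - apply: eq_integral => w _.
      by rewrite -!EFinM opprD expRD; congr (_%:E); ring.
    - by rewrite mulr_ge0 ?powpos_ge0 ?expR_ge0.
    - by measurability.
    - by move=> w; rewrite mule_ge0.
  rewrite ge0_integralMl.
  - by rewrite (integral_powpos_expRN a01) -EFinM mulrC.
  - exact: ltW (Gamma_gt0 c01).
  - by measurability.
  - by move=> w; rewrite mule_ge0.
apply: (mulEFin_injr Gac).
by rewrite bE -EFinM mulfVK// gt_eqF.
Qed.

End Beta.

(** * Semigroup law and Mellin transform of the heat kernel *)

Section HeatKernel.
Variable R : realType.
Local Notation mu := (@lebesgue_measure R).
Local Open Scope ereal_scope.

Lemma heat_ge0 (v z : R) : (0 <= heat v z)%R.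
Proof. by rewrite mulr_ge0 ?powR_ge0 ?expR_ge0. Qed.

Lemma heatN (v z : R) : heat v (- z) = heat v z.
Proof. by rewrite /heat sqrrN. Qed.

Lemma powRN2V (u : R) : (0 <= u)%R -> (u `^ (- 2^-1) = (Num.sqrt u)^-1)%R.
Proof. by move=> u0; rewrite powRN powR12_sqrt. Qed.

Lemma heat_normal_pdf (v m z : R) : (0 < v)%R ->
  heat v (z - m) = normal_pdf m (Num.sqrt (v / 2)) z.
Proof.
move=> v0; have v20 : (0 < v / 2)%R by rewrite divr_gt0.
rewrite normal_pdfE ?gt_eqF ?sqrtr_gt0// /heat /normal_peak /normal_fun.
rewrite sqr_sqrtr ?(ltW v20)// powRN2V ?mulr_ge0 ?pi_ge0 ?(ltW v0)//.
rewrite powR_inv1 ?(ltW v0)//; congr ((Num.sqrt _)^-1 * expR _)%R.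
  by rewrite -mulr_natr; field.
by rewrite -mulr_natr divfK// mulNr.
Qed.

Lemma integral_heat (v x : R) : (0 < v)%R -> \int[mu]_y (heat v (x - y))%:E = 1.
Proof.
move=> v0; rewrite -(integral_normal_pdf x (Num.sqrt (v / 2))).
by apply: eq_integral => y _; rewrite -heat_normal_pdf// -heatN opprB.
Qed.

(** Completing the square in y: the second factor on the right is a normal density in y of mass 1,
    so integrating over y leaves the semigroup law. *)
Lemma heat_mul (v w x y : R) : (0 < v)%R -> (0 < w)%R ->
  (heat v (x - y) * heat w y =
   heat (v + w) x * heat (v * w / (v + w)) (y - x * w / (v + w)))%R.
Proof.
rewrite /heat; move: (@pi R) (@pi_gt0 R) => P P0 v0 w0.
have vw0 : (0 < v + w)%R by exact: addr_gt0.
have vwV0 : (0 < v * w / (v + w))%R by rewrite divr_gt0 ?mulr_gt0.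
rewrite (powR_inv1 (ltW v0)) (powR_inv1 (ltW w0)) (powR_inv1 (ltW vw0)).
rewrite (powR_inv1 (ltW vwV0)).
have HA : ((P * v) `^ (- 2^-1) * (P * w) `^ (- 2^-1) =
    (P * (v + w)) `^ (- 2^-1) * (P * (v * w / (v + w))) `^ (- 2^-1))%R.
  rewrite -(powRM _ (ltW (mulr_gt0 P0 v0)) (ltW (mulr_gt0 P0 w0))).
  rewrite -(powRM _ (ltW (mulr_gt0 P0 vw0)) (ltW (mulr_gt0 P0 vwV0))).
  by congr (_ `^ _)%R; field; rewrite !lt0r_neq0.
have HE : (expR (- ((x - y) ^+ 2 * v^-1)) * expR (- (y ^+ 2 * w^-1)) =
    expR (- (x ^+ 2 * (v + w)^-1)) *
    expR (- ((y - x * w / (v + w)) ^+ 2 * (v * w / (v + w))^-1)))%R.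
  by rewrite -!expRD; congr expR; field; rewrite !lt0r_neq0.
by rewrite mulrACA HA HE mulrACA.
Qed.

Lemma heat_semigroup (v w x : R) : (0 < v)%R -> (0 < w)%R ->
  \int[mu]_y (heat v (x - y) * heat w y)%:E = (heat (v + w) x)%:E.
Proof.
move=> v0 w0; set u := (v * w / (v + w))%R; set m := (x * w / (v + w))%R.
have u0 : (0 < u)%R by rewrite divr_gt0 ?mulr_gt0 ?addr_gt0.
transitivity (\int[mu]_y ((heat (v + w) x)%:E * (heat u (m - y))%:E)).
  apply: eq_integral => y _; rewrite heat_mul// EFinM; congr (_ * _%:E).
  by rewrite -heatN opprB.
rewrite ge0_integralMl ?heat_ge0//.
- by rewrite integral_heat// mule1.
- by measurability.
- by move=> y; rewrite lee_fin heat_ge0.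
Qed.

(** The inversion r = 1 / w turns exp (- y^2 / w) into exp (- y^2 r), and the integral into a Gamma
    integral with parameter 1/2 - c. *)
Lemma integral_powpos_heat (c y : R) : (0 < 2^-1 - c <= 1)%R -> y != 0%R ->
  \int[mu]_w ((powpos c w)%:E * (heat w y)%:E) =
  (pi `^ (- 2^-1) * Gamma (2^-1 - c) * `|y| `^ (2 * c - 1))%:E.
Proof.
move=> c01 y0.
have y20 : (0 < y ^+ 2)%R by rewrite exprn_even_gt0.
(* The Haar density [powpos 0] lowers the parameter by 1, hence 3/2 - c in place of 1/2 - c. *)
pose f (r : R) := (powpos (3 / 2 - c) r * expR (- (y ^+ 2 * r)))%:E.
transitivity (\int[mu]_w ((pi `^ (- 2^-1))%:E *
    ((powpos 0 w)%:E * f (w `^ (-1))%R))).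
  apply: eq_integral => w _; rewrite /f; have [w0|w0] := ltP 0%R w; last first.
    by rewrite !(powpos_eq0 _ w0) !mul0e mule0.
  rewrite powR_inv1 ?(ltW w0)// powposV -!EFinM; congr (_%:E).
  rewrite /heat powRM ?pi_ge0 ?(ltW w0)// powR_inv1 ?(ltW w0)//.
  rewrite !mulrA; congr (_ * _)%R.
  rewrite (mulrC (powpos c w)) -!mulrA; congr (_ * _)%R.
  rewrite powpos_mul /powpos w0 -powRD ?(gt_eqF w0) ?implybT//.
  by congr powR; field.
rewrite ge0_integralMl; last 3 first.
- exact: powR_ge0.
- by rewrite /f; measurability.
- by move=> w; rewrite -EFinM lee_fin !mulr_ge0 ?powpos_ge0 ?expR_ge0.
rewrite integral_powpos_inv; last 2 first.
- by rewrite /f; measurability.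
- by move=> w; rewrite lee_fin !mulr_ge0 ?powpos_ge0 ?expR_ge0.
transitivity ((pi `^ (- 2^-1))%:E *
    \int[mu]_r ((powpos (2^-1 - c) r)%:E * (expR (- (y ^+ 2 * r)))%:E)).
  congr (_ * _); apply: eq_integral => r _; rewrite /f -!EFinM mulrA powpos_mul.
  by congr ((powpos _ _ * _)%:E); field.
rewrite integral_powpos_expRM// -EFinM mulrA; congr ((_ * _)%:E).
rewrite -(ger0_norm (ltW y20)) normrX -powR_mulrn// -powRrM.
by congr powR; field.
Qed.

End HeatKernel.

(** * Potential of the Schur weight *)

Section Weight.
Variable R : realType.
Local Notation mu := (@lebesgue_measure R).
Local Open Scope ereal_scope.

Let powposE_ge0 s t : 0 <= (powpos s t : R)%:E.
Proof. by rewrite lee_fin powpos_ge0. Qed.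

Let heatE_ge0 v z : 0 <= (heat v z : R)%:E.
Proof. by rewrite lee_fin heat_ge0. Qed.

(* The power [`|y| `^ (2 * c - 1)] is a superposition of heat kernels, so the
   semigroup law reduces its potential to [integral_powpos_add]. *)
Lemma integral_heat_power_le (a c x : R) :
  (0 < a)%R -> (0 < c)%R -> (a + c < 2^-1)%R -> x != 0%R ->
  \int[mu]_v ((powpos a v)%:E *
    \int[mu]_y (heat v (x - y) * `|y| `^ (2 * c - 1))%:E) <=
  (Gamma a * Gamma c / Gamma (a + c) *
   (Gamma (2^-1 - (a + c)) / Gamma (2^-1 - c)) *
   `|x| `^ (2 * (a + c) - 1))%:E.
Proof.
move=> a0 c0 ac x0.
have cc : (0 < 2^-1 - c <= 1)%R by apply/andP; split; lra.
have cac : (0 < 2^-1 - (a + c) <= 1)%R by apply/andP; split; lra.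
pose P := ((pi : R) `^ (- 2^-1))%R.
have P0 : (0 < P)%R by rewrite powR_gt0 ?pi_gt0.
have Gc0 := Gamma_gt0 cc.
pose K := (P * Gamma (2^-1 - c))%R.
have K0 : (0 < K)%R by rewrite mulr_gt0.
have KV0 : (0 <= K^-1)%R by rewrite invr_ge0 ltW.
pose W (y : R) := \int[mu]_w ((powpos c w)%:E * (heat w y)%:E).
(* Equality off the origin. At y = 0 the negative power has the default value 0, so only an
   inequality holds for all y. *)
have pW y : (`|y| `^ (2 * c - 1))%:E <= (K^-1)%:E * W y.
  have [->|y0] := eqVneq y 0%R.
    rewrite normr0 powR0; last by apply/eqP; lra.
    by rewrite mule_ge0 ?lee_fin//; apply: integral_ge0 => w _; rewrite mule_ge0.
  rewrite /W (integral_powpos_heat cc y0) -EFinM lee_fin -/P -/K.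
  by rewrite mulKf// gt_eqF.
pose f (u : R) := (heat u x)%:E.
have mf : measurable_fun [set: R] f by rewrite /f; measurability.
have f0 u : 0 <= f u by rewrite lee_fin heat_ge0.
pose H v y w := (heat v (x - y))%:E * ((powpos c w)%:E * (heat w y)%:E).
have H0 v y w : 0 <= H v y w by rewrite !mule_ge0.
have mH v : measurable_fun [set: R * R] (fun z => H v z.1 z.2).
  by rewrite /H; measurability.
have mW : measurable_fun [set: R] W.
  apply: measurable_fun_ge0_integral => [|y w]; last by rewrite mule_ge0.
  by rewrite /=; measurability.
have W0 y : 0 <= W y by apply: integral_ge0 => w _; rewrite mule_ge0.
have inner v : (0 < v)%R ->
    \int[mu]_y (heat v (x - y) * `|y| `^ (2 * c - 1))%:E <=
    (K^-1)%:E * \int[mu]_w ((powpos c w)%:E * f (v + w)%R).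
  move=> v0.
  apply: (@le_trans _ _ (\int[mu]_y ((K^-1)%:E * ((heat v (x - y))%:E * W y)))).
    apply: ge0_le_integral => //.
    - by move=> y _; rewrite lee_fin mulr_ge0 ?heat_ge0 ?powR_ge0.
    - by measurability.
    - by measurability.
    - by move=> y _; rewrite muleCA EFinM; exact: lee_wpmul2l.
  rewrite ge0_integralMl; last 3 first.
  - exact: KV0.
  - by measurability.
  - by move=> y; rewrite mule_ge0.
  rewrite lee_pmul2l ?lte_fin ?invr_gt0//.
  rewrite le_eqVlt; apply/orP; left; apply/eqP.
  transitivity (\int[mu]_y \int[mu]_w H v y w).
    apply: eq_integral => y _; rewrite /H ge0_integralMl//.
    - exact: heat_ge0.
    - by measurability.
    - by move=> w; rewrite mule_ge0.
  transitivity (\int[mu]_w \int[mu]_y H v y w).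
    exact: (@ge0_integral_swap R (H v) (mH v) (H0 v)).
  apply: eq_integral => w _; have [w0|w0] := ltP 0%R w; last first.
    rewrite (powpos_eq0 _ w0) mul0e; apply: integral0_eq => y _.
    by rewrite /H (powpos_eq0 _ w0) mul0e mule0.
  rewrite /f -heat_semigroup// -ge0_integralMl; last 3 first.
  - exact: powpos_ge0.
  - by measurability.
  - by move=> y; rewrite EFinM mule_ge0.
  by apply: eq_integral => y _; rewrite /H EFinM [LHS]muleCA.
have mF : measurable_fun [set: R] (fun v =>
    \int[mu]_w ((powpos a v)%:E * (powpos c w)%:E * f (v + w)%R)).
  apply: measurable_fun_ge0_integral => [|v w]; last by rewrite !mule_ge0.
  by measurability.
have F0 v : 0 <= \int[mu]_w ((powpos a v)%:E * (powpos c w)%:E * f (v + w)%R).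
  by apply: integral_ge0 => w _; rewrite !mule_ge0.
apply: (@le_trans _ _ (\int[mu]_v ((K^-1)%:E * \int[mu]_w
    ((powpos a v)%:E * (powpos c w)%:E * f (v + w)%R)))).
  apply: ge0_le_integral; first by [].
  - move=> v _; rewrite mule_ge0//; apply: integral_ge0 => y _.
    by rewrite lee_fin mulr_ge0 ?heat_ge0 ?powR_ge0.
  - apply: emeasurable_funM; first by measurability.
    apply: measurable_fun_ge0_integral => [|v y]; first by measurability.
    by rewrite lee_fin mulr_ge0 ?heat_ge0 ?powR_ge0.
  - by apply: emeasurable_funM; [exact: measurable_cst|exact: mF].
  - move=> v _; have [v0|v0] := ltP 0%R v; last first.
      apply: (@le_trans _ _ 0); first by rewrite (powpos_eq0 _ v0) mul0e.
      by apply: mule_ge0; [rewrite lee_fin|exact: F0].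
    apply: (le_trans (lee_wpmul2l (powposE_ge0 _ _) (inner v v0))).
    rewrite muleCA -ge0_integralMl; last 3 first.
    - exact: powpos_ge0.
    - by measurability.
    - by move=> w; rewrite mule_ge0.
    by under eq_integral do rewrite muleA.
rewrite ge0_integralMl; last 3 first.
- exact: KV0.
- exact: mF.
- exact: F0.
have ac1 : (a + c <= 1)%R by lra.
rewrite (integral_powpos_add a0 c0 ac1 mf f0) (integral_powpos_heat cac x0).
rewrite -/P -!EFinM lee_fin /K le_eqVlt; apply/orP; left; apply/eqP.
have Gac0 : (0 < Gamma (a + c))%R.
  by apply: Gamma_gt0; rewrite addr_gt0//=; lra.
move: (_ `^ (2 * (a + c) - 1))%R (Gamma (2^-1 - (a + c)))%R (Gamma a) (Gamma c).
move=> X G1 G2 G3; move: Gac0 Gc0 P0.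
move: (Gamma (a + c)) (Gamma (2^-1 - c))%R (P).
by move=> G4 G5 Q /lt0r_neq0 G40 /lt0r_neq0 G50 /lt0r_neq0 Q0; field; apply/and3P.
Qed.

End Weight.

(** * Cosine transform of the Gaussian *)

Section GaussianFourier.
Variable R : realType.
Local Notation mu := (@lebesgue_measure R).

Lemma is_derive_heat (v x : R) :
  is_derive x (1 : R) (heat v) (- (2 * x * v `^ (-1)) * heat v x).
Proof.
have dX : is_derive x (1 : R) (fun y : R => y * y) (x + x).
  by apply: is_derive_eq; rewrite /GRing.scale/= mulr1.
have dE : is_derive x (1 : R) (fun y : R => - v `^ (-1) * (y * y))
    (- v `^ (-1) * (x + x)) by exact: is_deriveZ.
have dF := is_deriveZ ((pi * v) `^ (- 2^-1)) (is_derive1_comp (is_derive_expR _) dE).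
have -> : heat v = ((pi * v) `^ (- 2^-1) \*:
    (expR \o (fun y : R => - v `^ (-1) * (y * y)))).
  by apply/funext => y; rewrite /heat/= expr2 [y * y * _]mulrC mulNr.
apply: is_derive_eq; rewrite /= /GRing.scale/=; ring.
Qed.

Lemma is_derive_cos_affine (z u x : R) :
  is_derive x (1 : R) (fun y : R => cos (z * y + u)) (- sin (z * x + u) * z).
Proof.
have dA : is_derive x (1 : R) (fun y : R => z * y + u) z.
  by apply: is_derive_eq; rewrite /GRing.scale/= mulr1 addr0.
exact: (is_derive1_comp (is_derive_cos _) dA).
Qed.

Lemma is_derive_sin_affine (z u x : R) :
  is_derive x (1 : R) (fun y : R => sin (z * y + u)) (cos (z * x + u) * z).
Proof.
have dA : is_derive x (1 : R) (fun y : R => z * y + u) z.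
  by apply: is_derive_eq; rewrite /GRing.scale/= mulr1 addr0.
exact: (is_derive1_comp (is_derive_sin _) dA).
Qed.

Lemma integrable_heat (v : R) : 0 < v ->
  mu.-integrable [set: R] (fun x => (heat v x)%:E).
Proof.
move=> v0; apply/integrableP; split; first by measurability.
have <- : (\int[mu]_y (heat v (0 - y))%:E = \int[mu]_x `|(heat v x)%:E|)%E.
  apply: eq_integral => x _.
  by rewrite sub0r heatN abse_EFin ger0_norm// heat_ge0.
by rewrite integral_heat// ltry.
Qed.

(** Half of the Gaussian exponent pays for the factor |x|. With t = x^2 / (2 v) one has |x| <= 1 +
    x^2 <= (1 + 2 v) (1 + t) and 1 + t <= exp t. The other half is the exponent of [heat (2 * v)],
    and [c] is the quotient of the normalizations. The bound provides both an integrable majorant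
    and decay at infinity. *)
Lemma norm_mul_heat_le (v : R) : 0 < v ->
  exists2 C : R, 0 <= C & forall x, `|x| * heat v x <= C * heat (2 * v) x.
Proof.
move=> v0; have v20 : 0 < 2 * v by rewrite mulr_gt0.
have pv0 : 0 < pi * (2 * v) by rewrite mulr_gt0 ?pi_gt0.
set c := (pi * v) `^ (- 2^-1) * (pi * (2 * v)) `^ 2^-1.
have c0 : 0 <= c by rewrite mulr_ge0 ?powR_ge0.
exists ((1 + 2 * v) * c) => [|y]; first by rewrite mulr_ge0// addr_ge0// ltW.
pose t := y ^+ 2 * (2 * v)^-1.
have t0 : 0 <= t by rewrite mulr_ge0 ?sqr_ge0// invr_ge0 ltW.
have -> : heat v y = c * heat (2 * v) y * expR (- t).
  rewrite /heat (powR_inv1 (ltW v20)) (powR_inv1 (ltW v0)) /c -!mulrA.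
  congr (_ * _); rewrite (powRN _ 2^-1) mulVKf ?gt_eqF ?powR_gt0// -expRD.
  by congr expR; rewrite /t; field; rewrite gt_eqF.
have -> : `|y| * (c * heat (2 * v) y * expR (- t)) =
    c * heat (2 * v) y * (`|y| * expR (- t)) by ring.
have -> : (1 + 2 * v) * c * heat (2 * v) y = c * heat (2 * v) y * (1 + 2 * v).
  by ring.
apply: ler_wpM2l; first by rewrite mulr_ge0 ?heat_ge0.
rewrite expRN ler_pdivrMr ?expR_gt0//.
apply: (@le_trans _ _ ((1 + 2 * v) * (1 + t))); last first.
  by rewrite ler_pM2l ?addr_gt0// expR_ge1Dx.
have y2t : `|y| ^+ 2 = 2 * v * t.
  by rewrite real_normK ?num_real// /t; field; rewrite gt_eqF.
have := sqr_ge0 (`|y| - 1); have := mulr_ge0 (ltW v20) t0.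
have := sqr_ge0 `|y|; nra.
Qed.

Lemma integrable_le (f g : R -> R) : measurable_fun [set: R] f ->
  (forall x, `|f x| <= g x) -> mu.-integrable [set: R] (EFin \o g) ->
  mu.-integrable [set: R] (EFin \o f).
Proof.
move=> mf fg; apply: le_integrable => //; first exact/measurable_EFinP.
by move=> x _; rewrite /= lee_fin (le_trans (fg x))// ler_norm.
Qed.

Lemma integrable_id_heat (v : R) : 0 < v ->
  mu.-integrable [set: R] (EFin \o (fun x => `|x| * heat v x)).
Proof.
move=> v0; have [C C0 HC] := norm_mul_heat_le v0.
apply: (@integrable_le _ (fun x => C * heat (2 * v) x)).
- by measurability.
- by move=> x; rewrite ger0_norm ?(mulr_ge0 _ (heat_ge0 _ _))//; exact: HC.
- have v20 : 0 < 2 * v by rewrite mulr_gt0.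
  exact: (integrableZl measurableT C (integrable_heat v20)).
Qed.

Lemma cvg_heat_nat (v : R) : 0 < v -> heat v n%:R @[n --> \oo] --> (0 : R).
Proof.
move=> v0; have [C C0 HC] := norm_mul_heat_le v0.
pose K := C * (pi * (2 * v)) `^ (- 2^-1).
rewrite -(cvg_shiftS (fun n => heat v n%:R)).
apply: (@squeeze_cvgr _ _ _ _ (cst 0) (fun n => K * harmonic n)).
(* Dividing the bound at x = n + 1 by x gives decay of order 1 / (n + 1). *)
- apply: nearW => n /=; rewrite heat_ge0/= ler_pdivlMr// mulrC.
  have := HC n.+1%:R; rewrite ger0_norm// => /le_trans; apply.
  rewrite /K; apply: ler_wpM2l => //.
  rewrite /heat ler_piMr ?powR_ge0// -expR0 ler_expR oppr_le0.
  by rewrite mulr_ge0 ?sqr_ge0 ?powR_ge0.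
- exact: cvg_cst.
- by rewrite -[X in _ --> X](mulr0 K); apply: cvgMr; exact: cvg_harmonic.
Qed.

Lemma integral_derive_eq0 (h h' g : R -> R) :
  (forall x, is_derive x (1 : R) h (h' x)) -> continuous h' ->
  mu.-integrable [set: R] (EFin \o g) -> (forall x, `|h' x| <= g x) ->
  h n%:R @[n --> \oo] --> (0 : R) -> h (- n%:R) @[n --> \oo] --> (0 : R) ->
  \int[mu]_x h' x = 0.
Proof.
move=> dh ch' ig h'g hy hNy.
(* The fundamental theorem needs a nondegenerate interval, hence n + 1. Dominated convergence then
   passes to the whole line, so the decay of [h] along the integers suffices. *)
pose I (n : nat) : set (measurableTypeR R) := `[- n.+1%:R, n.+1%:R]%classic.
have mh' : measurable_fun [set: R] h' by exact: continuous_measurable_fun.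
have mI n : measurable (I n) by rewrite /I; exact: measurable_itv.
have mh'I n : measurable_fun [set: R] ((EFin \o h') \_ (I n)).
  refine (proj1 (measurable_restrictT (EFin \o h') (mI n)) _).
  by apply: measurable_funTS; apply/measurable_EFinP.
have FTC n : (\int[mu]_x ((EFin \o h') \_ (I n)) x =
    (h n.+1%:R - h (- n.+1%:R))%:E)%E.
  rewrite -integral_mkcond.
  rewrite (@continuous_FTC2 _ _ h)//.
  - by rewrite (@lt_trans _ _ 0)// oppr_lt0.
  - exact: continuous_subspaceT.
  - have ch x : {for x, continuous h}.
      apply/differentiable_continuous/derivable1_diffP.
      by have [] := dh x.
    split; first by move=> x _; have [] := dh x.
    + by apply: cvg_at_right_filter; exact: ch.
    + by apply: cvg_at_left_filter; exact: ch.
  - by move=> x _; rewrite derive1E; have [_] := dh x.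
have mh'E : measurable_fun [set: R] (EFin \o h') by apply/measurable_EFinP.
have cv : {ae mu, forall x, [set: R] x ->
    ((EFin \o h') \_ (I n)) x @[n --> \oo] --> (EFin \o h') x}.
  apply: aeW => x _; apply: cvg_near_cst; near=> n.
  rewrite patchE mem_set// /I/= in_itv/= -ler_norml.
  rewrite (@le_trans _ _ n%:R) ?ler_nat//; near: n; exact: nbhs_infty_ger.
have bd : {ae mu, forall x n, [set: R] x ->
    (`|((EFin \o h') \_ (I n)) x| <= (EFin \o g) x)%E}.
  apply: aeW => x n _; rewrite patchE; case: ifPn => _ /=; first by rewrite lee_fin.
  by rewrite normr0 lee_fin (le_trans _ (h'g x)).
have [_ _] := @dominated_convergence _ (measurableTypeR R) R mu setT
  measurableT _ _ _ mh'I mh'E cv ig bd.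
move=> /(cvg_lim (@ereal_hausdorff R)) dom.
rewrite /Rintegral -[X in fine X]dom.
have -> : (fun n => \int[mu]_x ((EFin \o h') \_ (I n)) x)%E =
    EFin \o (fun n => h n.+1%:R - h (- n.+1%:R)).
  by apply/funext => n; exact: FTC.
have Hc : h n.+1%:R - h (- n.+1%:R) @[n --> \oo] --> (0 : R).
  rewrite -[X in _ --> X]subr0; apply: cvgB.
    by move: hy; rewrite -(cvg_shiftS (fun n => h n%:R)).
  by move: hNy; rewrite -(cvg_shiftS (fun n => h (- n%:R))).
by rewrite EFin_lim; [rewrite (cvg_lim _ Hc)|apply/cvg_ex; exists 0].
Unshelve. all: end_near. Qed.

Lemma norm_cos_le1 (x : R) : `|cos x| <= 1.
Proof. by rewrite ler_norml cos_geN1 cos_le1. Qed.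

Lemma norm_sin_le1 (x : R) : `|sin x| <= 1.
Proof. by rewrite ler_norml sin_geN1 sin_le1. Qed.

(** Integration by parts, in the form that the derivative of h x = heat v x * sin (y x + u) has
    integral 0: the factor x comes from differentiating the Gaussian, the cosine from
    differentiating the sine. *)
Lemma integral_id_heat_sin (v u y : R) : 0 < v ->
  \int[mu]_x (heat v x * (- sin (y * x + u) * x)) =
  - (v * y / 2) * \int[mu]_x (heat v x * cos (y * x + u)).
Proof.
move=> v0.
pose d (x : R) := heat v x * (- sin (y * x + u) * x).
pose f (x : R) := heat v x * cos (y * x + u).
have md : measurable_fun [set: R] d by rewrite /d; measurability.
have mf : measurable_fun [set: R] f by rewrite /f; measurability.
have d_le x : `|d x| <= `|x| * heat v x.
  rewrite /d normrM (ger0_norm (heat_ge0 _ _)) [leRHS]mulrC ler_wpM2l ?heat_ge0//.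
  by rewrite normrM normrN ler_piMl// norm_sin_le1.
have f_le x : `|f x| <= heat v x.
  rewrite /f normrM (ger0_norm (heat_ge0 _ _)) ler_piMr ?heat_ge0//.
  exact: norm_cos_le1.
have Id := integrable_le md d_le (integrable_id_heat v0).
have If := integrable_le mf f_le (integrable_heat v0).
pose h (x : R) := heat v x * sin (y * x + u).
pose h' (x : R) := y * f x + 2 / v * d x.
have dh x : is_derive x (1 : R) h (h' x).
  apply: is_derive_eq
    (is_deriveM (is_derive_heat v x) (is_derive_sin_affine y u x)) _.
  rewrite /GRing.scale/= /h' /f /d (powR_inv1 (ltW v0)).
  by field; rewrite gt_eqF.
have ch' : continuous h'.
  move=> x; apply/differentiable_continuous/derivable1_diffP.
  have dd := is_deriveM (is_derive_heat v x)
    (is_deriveM (is_deriveN (is_derive_sin_affine y u x)) (is_derive_id x (1 : R))).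
  have df := is_deriveM (is_derive_heat v x) (is_derive_cos_affine y u x).
  by have [] := is_deriveD (is_deriveZ y df) (is_deriveZ (2 / v) dd).
have hy : h n%:R @[n --> \oo] --> (0 : R).
  apply: norm_cvg0.
  apply: (@squeeze_cvgr _ _ _ _ (cst 0) _ _ _ _ _ (cvg_heat_nat v0)).
    apply: nearW => n /=; rewrite normr_ge0/= /h normrM (ger0_norm (heat_ge0 _ _)).
    by rewrite ler_piMr ?heat_ge0// norm_sin_le1.
  exact: cvg_cst.
have hNy : h (- n%:R) @[n --> \oo] --> (0 : R).
  apply: norm_cvg0.
  apply: (@squeeze_cvgr _ _ _ _ (cst 0) _ _ _ _ _ (cvg_heat_nat v0)).
    apply: nearW => n /=; rewrite normr_ge0/= /h normrM (ger0_norm (heat_ge0 _ _)).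
    by rewrite heatN ler_piMr ?heat_ge0// norm_sin_le1.
  exact: cvg_cst.
have mh' : measurable_fun [set: R] h' by exact: continuous_measurable_fun.
have I1 : mu.-integrable [set: R] (EFin \o (fun x => y * f x)).
  exact: (integrableZl measurableT y If).
have I2 : mu.-integrable [set: R] (EFin \o (fun x => 2 / v * d x)).
  exact: (integrableZl measurableT (2 / v) Id).
have Ih' : mu.-integrable [set: R] (EFin \o (fun x => `|h' x|)).
  by have := integrable_abse (integrableD measurableT I1 I2).
have := integral_derive_eq0 dh ch' Ih' (fun x => lexx _) hy hNy.
rewrite /h' RintegralD// RintegralZl// RintegralZl//.
rewrite -/(\int[mu]_x f x) -/(\int[mu]_x d x).
move: (\int[mu]_x f x) (\int[mu]_x d x) => X Y XY.
have v_neq0 := lt0r_neq0 v0.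
have -> : Y = v / 2 * (y * X + 2 / v * Y) - v * y / 2 * X by field.
by rewrite XY mulr0 sub0r mulNr.
Qed.

Lemma is_derive_integral_heat_cos (v u y : R) : 0 < v ->
  is_derive y (1 : R) (fun z => \int[mu]_x (heat v x * cos (z * x + u)))
    (- (v * y / 2) * \int[mu]_x (heat v x * cos (y * x + u))).
Proof.
move=> v0.
pose f (z x : R) := heat v x * cos (z * x + u).
have d1f z x : is_derive z (1 : R) (f ^~ x) (heat v x * (- sin (z * x + u) * x)).
  have -> : f ^~ x = heat v x \*: (fun z => cos (x * z + u)).
    by apply/funext => t; rewrite /f (mulrC t).
  by rewrite (mulrC z); exact: is_deriveZ (is_derive_cos_affine x u z).
have p1 z x : partial1of2 f z x = heat v x * (- sin (z * x + u) * x).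
  by rewrite partial1of2E; have [_] := d1f z x.
have ub z x : `|partial1of2 f z x| <= `|x| * heat v x.
  rewrite p1 normrM (ger0_norm (heat_ge0 _ _)) [leRHS]mulrC ler_wpM2l ?heat_ge0//.
  by rewrite normrM normrN ler_piMl// norm_sin_le1.
have If z : mu.-integrable [set: R] (EFin \o f z).
  apply: integrable_le (integrable_heat v0); first by rewrite /f; measurability.
  move=> x; rewrite /f normrM (ger0_norm (heat_ge0 _ _)) ler_piMr ?heat_ge0//.
  exact: norm_cos_le1.
have IG := integrable_id_heat v0.
have Iy : `]y - 1, y + 1[%classic y by rewrite /= in_itv/= ltrBlDr ltrDl ltr01.
have df z x : derivable (f ^~ x) z 1 by have [] := d1f z x.
have G0 (x : R) : 0 <= `|x| * heat v x by rewrite mulr_ge0 ?heat_ge0.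
(* The majorant |x| heat v x does not depend on the frequency, so any window around y serves; its
   half-width 1 is arbitrary. *)
apply: DeriveDef.
  exact: (@derivable_under_integral R _ _ mu f setT measurableT y (y - 1) (y + 1)
    Iy (fun z _ => If z) (fun z x _ _ => df z x) _ G0 IG
    (fun z x _ _ => ub z x)).
rewrite -derive1E.
rewrite (@differentiation_under_integral R _ _ mu f setT measurableT y
  (y - 1) (y + 1)
    Iy (fun z _ => If z) (fun z x _ _ => df z x) _ G0 IG
    (fun z x _ _ => ub z x)).
under eq_Rintegral do rewrite p1.
exact: integral_id_heat_sin.
Qed.

(** As a function of the frequency the integral solves Phi' y = - (v y / 2) Phi y, so exp (v y^2 /
    4) Phi y is constant, equal to its value cos u at 0. The free phase [u] makes one formula serve
    cosine and sine. *)
Lemma integral_heat_cos (v z u : R) : 0 < v ->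
  \int[mu]_x (heat v x * cos (z * x + u)) = expR (- (v * z ^+ 2 / 4)) * cos u.
Proof.
move=> v0.
pose Phi z := \int[mu]_x (heat v x * cos (z * x + u)).
pose F y := expR (v / 4 * (y * y)) * Phi y.
have dF y : is_derive y (1 : R) F 0.
  have dX : is_derive y (1 : R) (fun x : R => x * x) (y + y).
    by apply: is_derive_eq; rewrite /GRing.scale/= mulr1.
  have dE := is_derive1_comp (is_derive_expR _) (is_deriveZ (v / 4) dX).
  have := is_deriveM dE (is_derive_integral_heat_cos u y v0).
  rewrite /= /GRing.scale/= -/(Phi y) => dF.
  by apply: is_derive_eq dF _; field.
have F0 : F 0 = cos u.
  rewrite /F mul0r mulr0 expR0 mul1r /Phi.
  under eq_Rintegral do rewrite mul0r add0r.
  rewrite RintegralZr//; last exact: integrable_heat.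
  rewrite /Rintegral -[X in fine X](_ : (\int[mu]_x (heat v (0 - x))%:E)%E = _).
    by rewrite integral_heat// mul1r.
  by apply: eq_integral => x _; rewrite sub0r heatN.
have := is_derive_0_is_cst z 0 dF.
rewrite F0 /F -/(Phi z) => <-.
by rewrite mulrA -expRD -expr2 (_ : _ + _ = 0) ?expR0 ?mul1r//; field.
Qed.

End GaussianFourier.

(** * Fubini for dominated real kernels and weighted squares *)

Section RealFubini.
Variable R : realType.
Local Notation mu := (@lebesgue_measure R).

Lemma integrableMl_EFin (k : R) (g : R -> R) :
  mu.-integrable [set: R] (EFin \o g) ->
  mu.-integrable [set: R] (EFin \o (fun x => k * g x)).
Proof. exact: (integrableZl measurableT k). Qed.

Lemma RintegralE (g : R -> R) : mu.-integrable [set: R] (EFin \o g) ->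
  (\int[mu]_x g x)%:E = (\int[mu]_x (g x)%:E)%E.
Proof. by move=> ig; rewrite /Rintegral fineK//; exact: integrable_fin_num ig. Qed.

Lemma Rintegral_swap (K : R -> R -> R) (g1 g2 : R -> R) :
  measurable_fun [set: R * R] (fun z => K z.1 z.2) ->
  mu.-integrable [set: R] (EFin \o g1) -> mu.-integrable [set: R] (EFin \o g2) ->
  (forall x, 0 <= g1 x) -> (forall y, 0 <= g2 y) ->
  (forall x y, `|K x y| <= g1 x * g2 y) ->
  mu.-integrable [set: R] (EFin \o (fun x => \int[mu]_y K x y)) /\
  \int[mu]_x \int[mu]_y K x y = \int[mu]_y \int[mu]_x K x y.
Proof.
move=> mK ig1 ig2 g1_ge0 g2_ge0 Kg.
have mg1 : measurable_fun [set: R] g1.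
  by apply/measurable_EFinP; exact: measurable_int ig1.
have mg2 : measurable_fun [set: R] g2.
  by apply/measurable_EFinP; exact: measurable_int ig2.
have mKx x : measurable_fun [set: R] (K x).
  exact: (measurableT_comp mK (measurable_pair1 x)).
have mKy y : measurable_fun [set: R] (K ^~ y).
  exact: (measurableT_comp mK (measurable_pair2 y)).
have iKx x : mu.-integrable [set: R] (EFin \o K x).
  exact: integrable_le (mKx x) (Kg x) (integrableMl_EFin (g1 x) ig2).
have iKy y : mu.-integrable [set: R] (EFin \o (K ^~ y)).
  apply: integrable_le (mKy y) _ (integrableMl_EFin (g2 y) ig1).
  by move=> x; rewrite mulrC.
pose F (z : measurableTypeR R * measurableTypeR R) := (K z.1 z.2)%:E.
have mF : measurable_fun setT F by apply/measurable_EFinP.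
have iF : (mu \x mu)%E.-integrable setT F.
  apply/(integrable12ltyP mu mu mF).
  apply: (@le_lt_trans _ _ (\int[mu]_x ((\int[mu]_y g2 y)%:E * (g1 x)%:E))%E).
    apply: ge0_le_integral => //.
    - by move=> x _; apply: integral_ge0.
    - apply: measurable_fun_ge0_integral => //.
      by apply: measurableT_comp => //; apply/measurable_EFinP.
    - by measurability.
    - move=> x _; rewrite muleC (RintegralE ig2) -ge0_integralMl//; last first.
        by apply/measurable_EFinP.
      apply: ge0_le_integral => //.
      + by apply: measurableT_comp => //; apply/measurable_EFinP; exact: mKx.
      + by measurability.
      + by move=> y _; rewrite -EFinM lee_fin.
  rewrite ge0_integralMl//; last 2 first.
  - by apply: Rintegral_ge0 => y _.
  - by apply/measurable_EFinP.
  by rewrite -(RintegralE ig1) -EFinM ltry.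
have FE := @Fubini _ _ _ _ R mu mu F iF.
have I1 := @integrable_fubini_F _ _ _ _ R mu mu F iF.
have E1 : fubini_F mu F = EFin \o (fun x => \int[mu]_y K x y).
  apply/funext => x; rewrite /fubini_F /= /Rintegral fineK//.
  exact: integrable_fin_num (iKx x).
have E2 : fubini_G mu F = EFin \o (fun y => \int[mu]_x K x y).
  apply/funext => y; rewrite /fubini_G /= /Rintegral fineK//.
  exact: integrable_fin_num (iKy y).
split; first by rewrite -E1.
transitivity (fine (\int[mu]_x fubini_F mu F x)%E); first by rewrite E1.
transitivity (fine (\int[mu]_x fubini_G mu F x)%E); last by rewrite E2.
by congr fine; exact: FE.
Qed.

(** The square of [A] is opened one factor at a time, so that each exchange involves only two
    variables and a product majorant: [gam] controls w, and [H] controls x and y. *)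
Lemma weighted_energy (gam H : R -> R) (h : R -> R -> R) :
  mu.-integrable [set: R] (EFin \o gam) -> (forall w, 0 <= gam w) ->
  mu.-integrable [set: R] (EFin \o H) -> (forall x, 0 <= H x) ->
  measurable_fun [set: R * R] (fun z => h z.1 z.2) ->
  (forall x w, `|h x w| <= H x) ->
  let A w := \int[mu]_x h x w in
  let k x y := \int[mu]_w (gam w * (h x w * h y w)) in
  [/\ mu.-integrable [set: R] (EFin \o (fun w => gam w * A w ^+ 2)),
      forall x, mu.-integrable [set: R] (EFin \o k x),
      mu.-integrable [set: R] (EFin \o (fun x => \int[mu]_y k x y)) &
      \int[mu]_w (gam w * A w ^+ 2) = \int[mu]_x \int[mu]_y k x y].
Proof.
move=> igam gam0 iH H0 mh hH A k.
have mgam : measurable_fun [set: R] gam.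
  by apply/measurable_EFinP; exact: measurable_int igam.
have mhs : measurable_fun [set: R * R] (fun z => h z.2 z.1).
  by have := measurableT_comp mh (@measurable_swap _ _ _ _).
have mhx x : measurable_fun [set: R] (h x).
  exact: (measurableT_comp mh (measurable_pair1 x)).
have mhw w : measurable_fun [set: R] (h ^~ w).
  exact: (measurableT_comp mh (measurable_pair2 w)).
have ihw w : mu.-integrable [set: R] (EFin \o (h ^~ w)).
  exact: integrable_le (mhw w) (hH ^~ w) iH.
pose M := \int[mu]_x H x.
have M0 : 0 <= M by exact: Rintegral_ge0.
have AM w : `|A w| <= M.
  apply: (le_trans (le_normr_Rintegral measurableT (ihw w))).
  apply: le_Rintegral => //.
  apply: integrable_le iH; last by move=> x; rewrite normr_id.
  exact: (measurableT_comp (@normr_measurable _ _) (mhw w)).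
(* Measurability of [A] is only reached through the weight: gam w * A w is a parameter integral with
   an integrable majorant. *)
pose gA w := gam w * A w.
have mgA : measurable_fun [set: R] gA.
  have [] := @Rintegral_swap (fun w x => gam w * h x w) gam H _ igam iH gam0 H0.
  - by measurability.
  - by move=> w x; rewrite normrM (ger0_norm (gam0 w)) ler_wpM2l.
  move=> iK _; have : (fun w => \int[mu]_x (gam w * h x w)) = gA.
    by apply/funext => w; rewrite RintegralZl.
  by move=> <-; apply/measurable_EFinP; exact: measurable_int iK.
have iMgam := integrableMl_EFin M igam.
have Mgam0 w : 0 <= M * gam w by rewrite mulr_ge0.
(* One copy of [A] stays as a factor bounded by [M]; integrating over x restores the square. *)
pose K1 w x := gA w * h x w.
have mK1 : measurable_fun [set: R * R] (fun z => K1 z.1 z.2).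
  by rewrite /K1; measurability.
have mK1s : measurable_fun [set: R * R] (fun z => K1 z.2 z.1).
  by rewrite /K1; measurability.
have K1_le w x : `|K1 w x| <= M * gam w * H x.
  rewrite /K1 /gA normrM ler_pM// normrM (ger0_norm (gam0 w)) mulrC.
  by rewrite ler_wpM2r.
have [iK1 K1_swap] := Rintegral_swap mK1 iMgam iH Mgam0 H0 K1_le.
have K1s_le x w : `|K1 w x| <= H x * (M * gam w) by rewrite mulrC.
have [iK1s _] := @Rintegral_swap (fun x w => K1 w x) _ _ mK1s iH iMgam H0 Mgam0
  K1s_le.
have K1A w : \int[mu]_x K1 w x = gam w * A w ^+ 2.
  by rewrite RintegralZl// /gA -mulrA.
have k_swap x : \int[mu]_w K1 w x = \int[mu]_y k x y.
  have [] := @Rintegral_swap (fun w y => gam w * (h x w * h y w)) gam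
    (fun y => H x * H y) _ igam (integrableMl_EFin (H x) iH) gam0.
  - by have mx := mhx x; measurability.
  - by move=> y; rewrite mulr_ge0.
  - move=> w y; rewrite normrM (ger0_norm (gam0 w)) ler_wpM2l//.
    by rewrite normrM ler_pM.
  move=> _ <-; apply: eq_Rintegral => w _.
  transitivity (\int[mu]_y (gam w * h x w * h y w)).
    by rewrite RintegralZl// /K1 /gA mulrAC.
  by apply: eq_Rintegral => y _; rewrite mulrA.
split.
- by under eq_fun do rewrite -K1A.
- move=> x.
  have [] := @Rintegral_swap (fun y w => gam w * (h x w * h y w))
    (fun y => H x * H y) gam _ (integrableMl_EFin (H x) iH) igam _ gam0.
  - by have mx := mhx x; measurability.
  - by move=> y; rewrite mulr_ge0.
  - move=> y w; rewrite normrM (ger0_norm (gam0 w)) mulrC ler_wpM2r//.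
    by rewrite normrM ler_pM.
  by [].
- by have -> : (fun x => \int[mu]_y k x y) = (fun x => \int[mu]_w K1 w x);
    [apply/funext => x; rewrite k_swap|].
- under eq_Rintegral do rewrite -K1A.
  by rewrite K1_swap; apply: eq_Rintegral => x _.
Qed.

End RealFubini.

(** * Gaussian-weighted energy of the transform *)

Section SaftEnergy.
Variable R : realType.
Local Notation mu := (@lebesgue_measure R).
Local Notation Re := (@complex.Re R).
Local Notation Im := (@complex.Im R).
Variables (A B D p q : R).
Hypothesis B_neq0 : B != 0.

Definition saft_phase (x w : R) : R :=
  (A * x ^+ 2 + 2 * x * (p - w) - 2 * w * (D * p - B * q) + D * w ^+ 2) / (2 * B).

Lemma normc_sqr (z : R[i]) : Normc.normc z ^+ 2 = Re z ^+ 2 + Im z ^+ 2.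
Proof. by case: z => a b /=; rewrite sqr_sqrtr// addr_ge0 ?sqr_ge0. Qed.

Lemma normc_ge0 (z : R[i]) : 0 <= Normc.normc z.
Proof. by case: z => a b; exact: sqrtr_ge0. Qed.

Lemma norm_Re_le (z : R[i]) : `|Re z| <= Normc.normc z.
Proof. by case: z => a b /=; rewrite -sqrtr_sqr ler_wsqrtr// lerDl sqr_ge0. Qed.

Lemma norm_Im_le (z : R[i]) : `|Im z| <= Normc.normc z.
Proof. by case: z => a b /=; rewrite -sqrtr_sqr ler_wsqrtr// lerDr sqr_ge0. Qed.

Lemma saft_kernelE (x w : R) : saft_kernel A B D p q x w =
  conjc (saft_const B) * (cos (saft_phase x w) +i* sin (saft_phase x w)).
Proof.
rewrite /saft_kernel; congr (_ * _).
have -> : ('i%C / (2 * B)%:C * (A * x ^+ 2 + 2 * x * (p - w) -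
    2 * w * (D * p - B * q) + D * w ^+ 2)%:C)%C = 0 +i* saft_phase x w.
  rewrite -fmorphV /saft_phase; move: (_ + D * w ^+ 2) ((2 * B)^-1) => u r.
  by apply/eqP; rewrite eq_complex /=; apply/andP; split; apply/eqP; ring.
rewrite /cexp /= expR0.
by apply/eqP; rewrite eq_complex /=; apply/andP; split; apply/eqP; ring.
Qed.

Lemma normc_saft_const :
  Normc.normc (conjc (saft_const B)) ^+ 2 = (2 * pi * `|B|)^-1.
Proof.
have normcJ (z : R[i]) : Normc.normc (conjc z) = Normc.normc z.
  by case: z => a b /=; rewrite sqrrN.
rewrite normcJ /saft_const Normc.normcV exprVn; congr (_^-1).
rewrite expr2 -Normc.normcM -expr2 sqr_sqrtc /= expr0n addr0 sqrtr_sqr.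
by rewrite normrM ger0_norm// mulr_ge0// pi_ge0.
Qed.

Lemma normc_saft_kernel (x w : R) :
  Normc.normc (saft_kernel A B D p q x w) = Normc.normc (conjc (saft_const B)).
Proof.
by rewrite saft_kernelE Normc.normcM /= cos2Dsin2 sqrtr1 mulr1.
Qed.

(* The real part of [F x w * conjc (F y w)], for the integrand [F] of the
   transform; its dependence on [w] is a single frequency. *)
Lemma saft_kernel_dot (z1 z2 : R[i]) (x y w : R) :
  let k x := saft_kernel A B D p q x w in
  let chi := (A * (x ^+ 2 - y ^+ 2) + 2 * p * (x - y)) / (2 * B) in
  Re (z1 * k x) * Re (z2 * k y) + Im (z1 * k x) * Im (z2 * k y) =
  (2 * pi * `|B|)^-1 *
  ((Re z1 * Re z2 + Im z1 * Im z2) * cos (- (x - y) / B * w + chi) +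
   (Im z1 * Re z2 - Re z1 * Im z2) * cos (- (x - y) / B * w + (chi + pi / 2))).
Proof.
move=> k chi; rewrite /k !saft_kernelE -normc_saft_const normc_sqr.
(* The sine is written as a cosine shifted by pi / 2, so that [integral_heat_cos] covers both terms.
   In the difference of the phases all terms in w alone cancel, which leaves the frequency - (x - y)
   / B. *)
rewrite addrA cosDpihalf.
have -> : - (x - y) / B * w + chi = saft_phase x w - saft_phase y w.
  by rewrite /chi /saft_phase; field.
rewrite cosB sinB.
case: z1 => a1 b1; case: z2 => a2 b2; case: (conjc _) => k1 k2 /=.
by ring.
Qed.

Variable f : R -> R[i].
Hypothesis mRe : measurable_fun [set: R] (fun x => Re (f x)).
Hypothesis mIm : measurable_fun [set: R] (fun x => Im (f x)).
Hypothesis If : mu.-integrable [set: R] (EFin \o (fun x => Normc.normc (f x))).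

Let F x w := f x * saft_kernel A B D p q x w.
Let kappa := conjc (saft_const B).

Lemma measurable_saft_phase :
  measurable_fun [set: R * R] (fun z => saft_phase z.1 z.2).
Proof. by rewrite /saft_phase; measurability. Qed.

Lemma measurable_saft_integrand :
  measurable_fun [set: R * R] (fun z => Re (F z.1 z.2)) /\
  measurable_fun [set: R * R] (fun z => Im (F z.1 z.2)).
Proof.
pose a x := Re (f x); pose b x := Im (f x).
have ma : measurable_fun [set: R] a by exact: mRe.
have mb : measurable_fun [set: R] b by exact: mIm.
pose k1 := Re kappa; pose k2 := Im kappa.
have mp := measurable_saft_phase.
split.
- have -> : (fun z : R * R => Re (F z.1 z.2)) = (fun z =>
      a z.1 * (k1 * cos (saft_phase z.1 z.2) - k2 * sin (saft_phase z.1 z.2)) -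
      b z.1 * (k1 * sin (saft_phase z.1 z.2) + k2 * cos (saft_phase z.1 z.2))).
    apply/funext => -[x w] /=; rewrite /F saft_kernelE /a /b /k1 /k2 -/kappa.
    by case: (f x) kappa => [u v] [k l] /=.
  by measurability.
- have -> : (fun z : R * R => Im (F z.1 z.2)) = (fun z =>
      a z.1 * (k1 * sin (saft_phase z.1 z.2) + k2 * cos (saft_phase z.1 z.2)) +
      b z.1 * (k1 * cos (saft_phase z.1 z.2) - k2 * sin (saft_phase z.1 z.2))).
    apply/funext => -[x w] /=; rewrite /F saft_kernelE /a /b /k1 /k2 -/kappa.
    by case: (f x) kappa => [u v] [k l] /=.
  by measurability.
Qed.

(** [weighted_energy] is applied to the real and imaginary parts of the integrand with weight
    [heat v]; the integral over w becomes the Gaussian at frequency (x - y) / B. The first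
    conclusion later yields the measurability of the energy density. *)
Lemma saft_energy (v : R) : 0 < v ->
  mu.-integrable [set: R]
    (EFin \o (fun w => heat v w * Normc.normc (saft A B D p q f w) ^+ 2)) /\
  (\int[mu]_w (heat v w * Normc.normc (saft A B D p q f w) ^+ 2)%:E <=
   \int[mu]_x \int[mu]_y ((2 * pi * `|B|)^-1 *
     (Normc.normc (f x) * Normc.normc (f y)) *
     expR (- (v * (- (x - y) / B) ^+ 2 / 4)))%:E)%E.
Proof.
move=> v0; have [mF1 mF2] := measurable_saft_integrand.
pose H x := Normc.normc (f x) * Normc.normc kappa.
have IH : mu.-integrable [set: R] (EFin \o H).
  have -> : H = (fun x => Normc.normc kappa * Normc.normc (f x)).
    by apply/funext => x; rewrite mulrC.
  exact: integrableMl_EFin.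
have H0 x : 0 <= H x by rewrite mulr_ge0 ?normc_ge0.
have normF x w : Normc.normc (F x w) = H x.
  by rewrite /F Normc.normcM normc_saft_kernel.
have F1H x w : `|Re (F x w)| <= H x by rewrite -(normF x w) norm_Re_le.
have F2H x w : `|Im (F x w)| <= H x by rewrite -(normF x w) norm_Im_le.
have Iv := integrable_heat v0.
have [iE1 ik1 iik1 E1] := weighted_energy Iv (heat_ge0 v) IH H0 mF1 F1H.
have [iE2 ik2 iik2 E2] := weighted_energy Iv (heat_ge0 v) IH H0 mF2 F2H.
split.
  have -> : (fun w => heat v w * Normc.normc (saft A B D p q f w) ^+ 2) =
      (fun w => heat v w * (\int[mu]_x Re (F x w)) ^+ 2 +
        heat v w * (\int[mu]_x Im (F x w)) ^+ 2).
    by apply/funext => w; rewrite normc_sqr mulrDr.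
  exact: (integrableD measurableT iE1 iE2).
pose k x y := \int[mu]_w (heat v w * (Re (F x w) * Re (F y w))) +
  \int[mu]_w (heat v w * (Im (F x w) * Im (F y w))).
have LHS_E : (\int[mu]_w (heat v w * Normc.normc (saft A B D p q f w) ^+ 2)%:E)%E =
    (\int[mu]_x \int[mu]_y k x y)%:E.
  transitivity (\int[mu]_w (heat v w * (\int[mu]_x Re (F x w)) ^+ 2 +
      heat v w * (\int[mu]_x Im (F x w)) ^+ 2)%:E)%E.
    by apply: eq_integral => w _; rewrite normc_sqr mulrDr.
  rewrite -RintegralE; last exact: (integrableD measurableT iE1 iE2).
  congr (_%:E).
  rewrite (RintegralD measurableT iE1 iE2) E1 E2 -(RintegralD measurableT iik1 iik2).
  apply: eq_Rintegral => x _; apply/esym.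
  exact: (RintegralD measurableT (ik1 x) (ik2 x)).
have k_le x y : `|k x y| <= (2 * pi * `|B|)^-1 *
     (Normc.normc (f x) * Normc.normc (f y)) *
     expR (- (v * (- (x - y) / B) ^+ 2 / 4)).
  set c := (2 * pi * `|B|)^-1.
  have c0 : 0 <= c by rewrite invr_ge0 !mulr_ge0 ?pi_ge0.
  have Ih (g1 g2 : R -> R -> R) :
      measurable_fun [set: R] (g1 x) -> measurable_fun [set: R] (g2 y) ->
      (forall x w, `|g1 x w| <= H x) -> (forall x w, `|g2 x w| <= H x) ->
      mu.-integrable [set: R] (EFin \o (fun w => heat v w * (g1 x w * g2 y w))).
    move=> m1 m2 H1 H2; apply: integrable_le (integrableMl_EFin (H x * H y) Iv).
      by measurability.
    move=> w; rewrite normrM (ger0_norm (heat_ge0 _ _)) mulrC ler_wpM2r ?heat_ge0//.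
    by rewrite normrM ler_pM.
  have mFx (g : R -> R -> R) (x' : R) :
      measurable_fun [set: R * R] (fun z => g z.1 z.2) ->
      measurable_fun [set: R] (g x').
    by move=> mg; exact: (measurableT_comp mg (measurable_pair1 x')).
  have Icos u : mu.-integrable [set: R]
      (EFin \o (fun w => heat v w * cos (- (x - y) / B * w + u))).
    apply: integrable_le Iv; first by measurability.
    move=> w; rewrite normrM (ger0_norm (heat_ge0 _ _)) ler_piMr ?heat_ge0//.
    exact: norm_cos_le1.
  (* P + i Q is f x times the conjugate of f y, and [chi] is the difference of the chirps at x and
     y. What remains is the real part of (P + i Q) exp (i chi), so passing to the modulus removes
     the chirp. *)
  pose P := Re (f x) * Re (f y) + Im (f x) * Im (f y).
  pose Q := Im (f x) * Re (f y) - Re (f x) * Im (f y).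
  pose chi := (A * (x ^+ 2 - y ^+ 2) + 2 * p * (x - y)) / (2 * B).
  have -> : k x y = c * (P * cos chi - Q * sin chi) *
      expR (- (v * (- (x - y) / B) ^+ 2 / 4)).
    rewrite /k -RintegralD//; last 2 first.
    - exact: (Ih (fun x w => Re (F x w)) (fun x w => Re (F x w)) (mFx _ x mF1)
        (mFx _ y mF1) F1H F1H).
    - exact: (Ih (fun x w => Im (F x w)) (fun x w => Im (F x w)) (mFx _ x mF2)
        (mFx _ y mF2) F2H F2H).
    transitivity (\int[mu]_w
      (c * P * (heat v w * cos (- (x - y) / B * w + chi)) +
       c * Q * (heat v w * cos (- (x - y) / B * w + (chi + pi / 2))))).
      apply: eq_Rintegral => w _; rewrite -mulrDr /F saft_kernel_dot.
      rewrite -/c -/chi -/P -/Q.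
      by ring.
    rewrite RintegralD//; last 2 first.
    - exact: integrableMl_EFin.
    - exact: integrableMl_EFin.
    rewrite !RintegralZl// !integral_heat_cos// cosDpihalf.
    by ring.
  rewrite normrM (ger0_norm (expR_ge0 _)) ler_wpM2r ?expR_ge0//.
  rewrite normrM (ger0_norm c0) ler_wpM2l//.
  rewrite -[leLHS]sqrtr_sqr -[leRHS]ger0_norm ?mulr_ge0 ?normc_ge0//.
  rewrite -[leRHS]sqrtr_sqr ler_wsqrtr// exprMn !normc_sqr.
  have -> : (Re (f x) ^+ 2 + Im (f x) ^+ 2) * (Re (f y) ^+ 2 + Im (f y) ^+ 2) =
      (P ^+ 2 + Q ^+ 2) * (cos chi ^+ 2 + sin chi ^+ 2).
    by rewrite cos2Dsin2 mulr1 /P /Q; ring.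
  rewrite -subr_ge0.
  have -> : (P ^+ 2 + Q ^+ 2) * (cos chi ^+ 2 + sin chi ^+ 2) -
      (P * cos chi - Q * sin chi) ^+ 2 = (P * sin chi + Q * cos chi) ^+ 2 by ring.
  exact: sqr_ge0.
have ik x : mu.-integrable [set: R] (EFin \o k x).
  exact: (integrableD measurableT (ik1 x) (ik2 x)).
have ir : mu.-integrable [set: R] (EFin \o (fun x => \int[mu]_y k x y)).
  have -> : (fun x => \int[mu]_y k x y) = (fun x =>
      \int[mu]_y (\int[mu]_w (heat v w * (Re (F x w) * Re (F y w)))) +
      \int[mu]_y (\int[mu]_w (heat v w * (Im (F x w) * Im (F y w))))).
    apply/funext => x.
    exact: (RintegralD measurableT (ik1 x) (ik2 x)).
  exact: (integrableD measurableT iik1 iik2).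
have mf : measurable_fun [set: R] (fun x => Normc.normc (f x)).
  by apply/measurable_EFinP; exact: measurable_int If.
pose nf x := Normc.normc (f x).
have mnf : measurable_fun [set: R] nf by [].
have bound_ge0 x y : 0 <= (2 * pi * `|B|)^-1 * (nf x * nf y) *
    expR (- (v * (- (x - y) / B) ^+ 2 / 4)).
  by rewrite !mulr_ge0 ?expR_ge0 ?invr_ge0 ?mulr_ge0 ?pi_ge0 ?normc_ge0.
have mbound : measurable_fun [set: R * R] (fun z =>
    ((2 * pi * `|B|)^-1 * (nf z.1 * nf z.2) *
    expR (- (v * (- (z.1 - z.2) / B) ^+ 2 / 4)))%:E).
  by measurability.
rewrite LHS_E (RintegralE ir).
apply: (le_trans (lee_abs _)).
have mr : measurable_fun [set: R] (EFin \o (fun x => \int[mu]_y k x y)).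
  exact: measurable_int ir.
apply: (le_trans (le_abse_integral mu measurableT mr)).
apply: ge0_le_integral => //.
- exact: measurableT_comp.
- apply: measurable_fun_ge0_integral; first exact: mbound.
  by move=> x y; rewrite lee_fin bound_ge0.
move=> x _.
have mkx : measurable_fun [set: R] (EFin \o k x) by exact: measurable_int (ik x).
rewrite [X in `|X|%E](RintegralE (ik x)).
apply: (le_trans (le_abse_integral mu measurableT mkx)).
apply: ge0_le_integral => //.
- exact: measurableT_comp.
- exact: (measurableT_comp mbound (measurable_pair1 x)).
- by move=> y _; rewrite abse_EFin lee_fin; exact: k_le.
Qed.

End SaftEnergy.

(** * Continuity and integrability of Schwartz functions *)

Section Schwartz.
Variable R : realType.
Local Notation mu := (@lebesgue_measure R).
Variable f : R -> R[i].
Hypothesis hf : schwartz f.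

Lemma schwartz_continuous :
  continuous (fun x => complex.Re (f x)) /\ continuous (fun x => complex.Im (f x)).
Proof.
have [sf _] := hf.
split => x; have [dRe dIm] := sf 0%N x.
  exact/differentiable_continuous/derivable1_diffP/dRe.
exact/differentiable_continuous/derivable1_diffP/dIm.
Qed.

Lemma schwartz_measurable :
  measurable_fun [set: R] (fun x => complex.Re (f x)) /\
  measurable_fun [set: R] (fun x => complex.Im (f x)).
Proof.
by have [c1 c2] := schwartz_continuous; split; exact: continuous_measurable_fun.
Qed.

Lemma integrable_oneDsqrV :
  mu.-integrable [set: R] (EFin \o (fun x => (1 + x ^+ 2)^-1)).
Proof.
pose g (x : R) := (1 + x ^+ 2)^-1; rewrite -/g.
have c1 : continuous g by exact: continuous_oneDsqrV.
have g0 (x : R) : 0 <= g x by rewrite invr_ge0 addr_ge0// sqr_ge0.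
apply/integrableP; split.
  by apply/measurable_EFinP; exact: continuous_measurable_fun.
have -> : (\int[mu]_x `|(EFin \o g) x| = \int[mu]_x (g x)%:E)%E.
  by apply: eq_integral => x _; rewrite /= ger0_norm.
rewrite ge0_symfun_integralT//; last by move=> x; rewrite /g/= sqrrN.
rewrite (_ : [set x | _] = `[0, +oo[%classic); last first.
  by apply/seteqP; split => x/=; rewrite in_itv/= andbT.
by have := @integral0y_oneDsqr R; rewrite /oneDsqr => ->; rewrite -EFinM ltry.
Qed.

Lemma schwartz_integrable :
  mu.-integrable [set: R] (EFin \o (fun x => Normc.normc (f x))).
Proof.
have [_ sf] := hf; have [M0 HM0] := sf 0%N 0%N; have [M2 HM2] := sf 2%N 0%N.
have [mRe mIm] := schwartz_measurable.
have mnf : measurable_fun [set: R] (fun x => Normc.normc (f x)).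
  have -> : (fun x => Normc.normc (f x)) =
      Num.sqrt \o (fun x => complex.Re (f x) ^+ 2 + complex.Im (f x) ^+ 2).
    by apply/funext => x /=; case: (f x).
  apply: measurableT_comp.
    by apply: continuous_measurable_fun => x; exact: sqrt_continuous.
  by apply: measurable_funD; apply: measurable_funX.
(* The decay bounds with m = 0 and m = 2 add up to (1 + x^2) |f x| <= M0 + M2. *)
apply: integrable_le mnf _ (integrableMl_EFin (M0 + M2) integrable_oneDsqrV) => x.
have fE : cderiven 0 f x = f x by rewrite /cderiven /=; case: (f x).
have := HM0 x; have := HM2 x; rewrite fE expr0 mul1r => H2 H0.
rewrite ger0_norm ?normc_ge0// ler_pdivlMr ?ltr_wpDr ?sqr_ge0//.
rewrite mulrDr mulr1 lerD// mulrC.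
by rewrite real_normK ?num_real in H2.
Qed.

End Schwartz.

(** * Schur test, contraction and Pitt's inequality *)

Section SaftPitt.
Variable R : realType.
Local Notation mu := (@lebesgue_measure R).

(** Schur's test for a symmetric kernel: the two terms of the arithmetic-geometric mean inequality
    are exchanged by x <-> y, so by Tonelli each contributes half of the right-hand side. The
    reciprocal of [p] is passed as [q], which forces p x to be nonzero at every point. *)
Lemma schur_symmetric (t : R) (u p q : R -> R) :
  measurable_fun [set: R] u -> measurable_fun [set: R] p ->
  measurable_fun [set: R] q -> (forall x, 0 <= u x) -> (forall x, 0 <= p x) ->
  (forall x, 0 <= q x) -> (forall x, p x * q x = 1) ->
  (\int[mu]_x \int[mu]_y (u x * u y * heat t (x - y))%:E <=
   \int[mu]_x ((u x ^+ 2 * q x)%:E * \int[mu]_y (heat t (x - y) * p y)%:E))%E.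
Proof.
move=> mu_ mp mq u0 p0 q0 pq.
pose T x y := (2^-1 * (u x ^+ 2 * q x * (heat t (x - y) * p y)))%:E.
have T0 x y : (0 <= T x y)%E.
  rewrite lee_fin mulr_ge0 ?invr_ge0//.
  exact: (mulr_ge0 (mulr_ge0 (sqr_ge0 _) (q0 x)) (mulr_ge0 (heat_ge0 _ _) (p0 y))).
have uuh0 x y : 0 <= u x * u y * heat t (x - y).
  exact: (mulr_ge0 (mulr_ge0 (u0 x) (u0 y)) (heat_ge0 _ _)).
have mT : measurable_fun [set: R * R] (fun z => T z.1 z.2).
  by rewrite /T; measurability.
have mTs : measurable_fun [set: R * R] (fun z => T z.2 z.1).
  by rewrite /T; measurability.
have mTx x : measurable_fun [set: R] (T x).
  exact: (measurableT_comp mT (measurable_pair1 x)).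
have mTy y : measurable_fun [set: R] (T ^~ y).
  exact: (measurableT_comp mT (measurable_pair2 y)).
have amgm x y : u x * u y * heat t (x - y) <=
    2^-1 * (u x ^+ 2 * q x * (heat t (x - y) * p y)) +
    2^-1 * (u y ^+ 2 * q y * (heat t (y - x) * p x)).
  rewrite -(heatN t (y - x)) opprB.
  have -> : 2^-1 * (u x ^+ 2 * q x * (heat t (x - y) * p y)) +
      2^-1 * (u y ^+ 2 * q y * (heat t (x - y) * p x)) =
      2^-1 * (u x ^+ 2 * q x * p y + u y ^+ 2 * q y * p x) * heat t (x - y) by ring.
  rewrite ler_wpM2r ?heat_ge0//.
  set X := u x ^+ 2 * q x * p y; set Y := u y ^+ 2 * q y * p x.
  have X0 : 0 <= X by rewrite !mulr_ge0 ?sqr_ge0.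
  have Y0 : 0 <= Y by rewrite !mulr_ge0 ?sqr_ge0.
  have XY : X * Y = (u x * u y) ^+ 2.
    rewrite -[RHS]mulr1 -[X in _ = _ * X](mulr1 1) -{1}(pq x) -(pq y) /X /Y.
    by ring.
  (* The weights cancel in X Y, so squaring reduces the claim to 4 X Y <= (X + Y)^2. *)
  rewrite ler_pdivlMl// -ler_sqr ?nnegrE ?addr_ge0 ?mulr_ge0//.
  by rewrite exprMn -XY -subr_ge0 (_ : _ - _ = (X - Y) ^+ 2) ?sqr_ge0//; ring.
apply: (@le_trans _ _ (\int[mu]_x \int[mu]_y (T x y + T y x))%E).
  apply: ge0_le_integral => //.
  - move=> x _; apply: integral_ge0 => y _.
    by rewrite lee_fin uuh0.
  - apply: measurable_fun_ge0_integral; first by measurability.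
    by move=> x y; rewrite lee_fin uuh0.
  - apply: measurable_fun_ge0_integral; last by move=> x y; rewrite adde_ge0.
    exact: emeasurable_funD.
  move=> x _; apply: ge0_le_integral => //.
  - by move=> y _; rewrite lee_fin uuh0.
  - by measurability.
  - by apply: emeasurable_funD; [exact: mTx|exact: mTy].
  - by move=> y _; rewrite lee_fin amgm.
rewrite le_eqVlt; apply/orP; left; apply/eqP.
transitivity (\int[mu]_x (\int[mu]_y T x y + \int[mu]_y T y x))%E.
  by apply: eq_integral => x _; apply: ge0_integralD => //; [exact: mTx|exact: mTy].
rewrite ge0_integralD//; last 4 first.
- by move=> x _; apply: integral_ge0.
- exact: measurable_fun_ge0_integral.
- by move=> x _; apply: integral_ge0.
- exact: (@measurable_fun_ge0_integral _ _ _ (fun x y => T y x)).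
have -> : (\int[mu]_x \int[mu]_y T y x = \int[mu]_x \int[mu]_y T x y)%E.
  exact: (@ge0_integral_swap _ (fun x y => T y x)).
have mTI : measurable_fun [set: R] (fun x => \int[mu]_y T x y)%E.
  exact: measurable_fun_ge0_integral.
rewrite -ge0_integralD//; last 2 first.
- by move=> x _; apply: integral_ge0.
- by move=> x _; apply: integral_ge0.
apply: eq_integral => x _.
rewrite -ge0_integralD//; last 2 first.
- exact: mTx.
- exact: mTx.
rewrite -ge0_integralMl; last 3 first.
- by rewrite mulr_ge0 ?sqr_ge0.
- by measurability.
- by move=> y; rewrite lee_fin; exact: (mulr_ge0 (heat_ge0 _ _) (p0 y)).
by apply: eq_integral => y _; rewrite /T -EFinD -EFinM; congr (_%:E); field.
Qed.

Variables (A B D p q : R).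
Hypothesis B_neq0 : B != 0.
Variable f : R -> R[i].
Hypothesis mRe : measurable_fun [set: R] (fun x => complex.Re (f x)).
Hypothesis mIm : measurable_fun [set: R] (fun x => complex.Im (f x)).
Hypothesis If : mu.-integrable [set: R] (EFin \o (fun x => Normc.normc (f x))).

(** The weighted energy density for v = 1 is integrable, hence measurable, and multiplication by
    sqrt pi * exp (w^2) undoes the weight. *)
Lemma measurable_normc_saft :
  measurable_fun [set: R] (fun w => Normc.normc (saft A B D p q f w) ^+ 2).
Proof.
have [IN _] := saft_energy A D p q B_neq0 mRe mIm If ltr01.
pose g w := heat 1 w * Normc.normc (saft A B D p q f w) ^+ 2.
have mg : measurable_fun [set: R] g.
  by apply/measurable_EFinP; exact: measurable_int IN.
have -> : (fun w => Normc.normc (saft A B D p q f w) ^+ 2) =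
    (fun w => g w * (pi `^ 2^-1 * expR (w ^+ 2))).
  apply/funext => w; rewrite /g /heat mulr1 powRN powR1 mulr1 expRN.
  have := expR_gt0 (w ^+ 2); have := powR_gt0 2^-1 (@pi_gt0 R).
  move: (pi `^ 2^-1) (expR (w ^+ 2)) (_ ^+ 2) => a b c a0 b0.
  by field; rewrite !lt0r_neq0.
by measurability.
Qed.

Lemma saft_energy_heat (t : R) : 0 < t ->
  (\int[mu]_w (expR (- (w ^+ 2 / (4 * B ^+ 2) * t)) *
     Normc.normc (saft A B D p q f w) ^+ 2)%:E <=
   \int[mu]_x \int[mu]_y
     (Normc.normc (f x) * Normc.normc (f y) * heat t (x - y))%:E)%E.
Proof.
(* This [v] makes the exponent v (x - y)^2 / (4 B^2) equal to (x - y)^2 / t and w^2 / v equal to w^2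
   t / (4 B^2). The factor [s] removes the normalization of [heat v], and s * sqrt (pi t) = 2 pi |B|
   turns the squared constant of the transform into the normalization of [heat t]. *)
move=> t0; pose v := 4 * B ^+ 2 / t.
have B20 : 0 < B ^+ 2 by rewrite exprn_even_gt0.
have B40 : 0 < 4 * B ^+ 2 by rewrite mulr_gt0// ltr0n.
have v0 : 0 < v by exact: divr_gt0.
have p0 := @pi_gt0 R.
have pv0 : 0 < pi * v by rewrite mulr_gt0.
have pt0 : 0 < pi * t by rewrite mulr_gt0.
pose s := Num.sqrt (pi * v).
have s0 : 0 < s by rewrite sqrtr_gt0.
have sE : s * Num.sqrt (pi * t) = 2 * pi * `|B|.
  rewrite /s -sqrtrM ?(ltW pv0)// (_ : pi * v * (pi * t) = (2 * pi * B) ^+ 2).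
    by rewrite sqrtr_sqr normrM ger0_norm// mulr_ge0// ltW.
  by rewrite /v; field; rewrite lt0r_neq0.
have [_ HE] := saft_energy A D p q B_neq0 mRe mIm If v0.
pose N w := Normc.normc (saft A B D p q f w) ^+ 2.
have mN : measurable_fun [set: R] N := measurable_normc_saft.
have -> : (\int[mu]_w (expR (- (w ^+ 2 / (4 * B ^+ 2) * t)) * N w)%:E =
    s%:E * \int[mu]_w (heat v w * N w)%:E)%E.
  rewrite -ge0_integralMl; last 3 first.
  - exact: ltW.
  - by measurability.
  - by move=> w; rewrite lee_fin mulr_ge0 ?heat_ge0 ?sqr_ge0.
  apply: eq_integral => w _; rewrite -EFinM [in RHS]mulrA; congr ((_ * _)%:E).
  rewrite /heat powRN2V ?(ltW pv0)// mulVKf ?lt0r_neq0// powR_inv1 ?(ltW v0)//.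
  by congr expR; rewrite /v; field; rewrite ?B_neq0 ?(lt0r_neq0 t0).
pose nf x := Normc.normc (f x).
have mnf : measurable_fun [set: R] nf.
  by apply/measurable_EFinP; exact: measurable_int If.
pose K x y := (2 * pi * `|B|)^-1 * (nf x * nf y) *
  expR (- (v * (- (x - y) / B) ^+ 2 / 4)).
have K0 x y : 0 <= K x y.
  by rewrite !mulr_ge0 ?expR_ge0 ?invr_ge0 ?mulr_ge0 ?pi_ge0 ?normc_ge0.
have mK : measurable_fun [set: R * R] (fun z => (K z.1 z.2)%:E).
  by rewrite /K; measurability.
apply: (le_trans (lee_wpmul2l _ HE)); first by rewrite lee_fin ltW.
rewrite -ge0_integralMl; last 3 first.
- exact: ltW.
- apply: measurable_fun_ge0_integral; first exact: mK.
  by move=> x y; rewrite lee_fin K0.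
- by move=> x; apply: integral_ge0 => y _; rewrite lee_fin K0.
rewrite le_eqVlt; apply/orP; left; apply/eqP; apply: eq_integral => x _.
rewrite -ge0_integralMl; last 3 first.
- exact: ltW.
- exact: (measurableT_comp mK (measurable_pair1 x)).
- by move=> y; rewrite lee_fin K0.
apply: eq_integral => y _; rewrite -EFinM /K; congr (_%:E).
rewrite /heat powRN2V ?(ltW pt0)// powR_inv1 ?(ltW t0)//.
have -> : (2 * pi * `|B|)^-1 = s^-1 * (Num.sqrt (pi * t))^-1.
  by rewrite -sE invfM.
have -> : v * (- (x - y) / B) ^+ 2 / 4 = (x - y) ^+ 2 * t^-1.
  by rewrite /v; field; rewrite B_neq0 lt0r_neq0.
move: (Num.sqrt (pi * t))^-1 (expR _) => r e.
by move: s0 => /lt0r_neq0 s_neq0; field.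
Qed.

Let N w := Normc.normc (saft A B D p q f w) ^+ 2.
Let nf x := Normc.normc (f x).

Let mN : measurable_fun [set: R] N.
Proof. exact: measurable_normc_saft. Qed.

Let N0 w : 0 <= N w. Proof. exact: sqr_ge0. Qed.

Let mnf : measurable_fun [set: R] nf.
Proof. by apply/measurable_EFinP; exact: measurable_int If. Qed.

Let nf0 x : 0 <= nf x. Proof. exact: normc_ge0. Qed.

(** The Gaussian factors increase to 1 along t = 1 / (n + 1), so monotone convergence removes them
    with no prior knowledge that the transform is square integrable; the bound is the same for every
    t because the heat kernel has mass 1. *)
Lemma saft_contraction :
  (\int[mu]_w (N w)%:E <= \int[mu]_x (nf x ^+ 2)%:E)%E.
Proof.
pose c (w : R) := w ^+ 2 / (4 * B ^+ 2).
have c0 w : 0 <= c w by rewrite divr_ge0 ?sqr_ge0// mulr_ge0 ?sqr_ge0// ler0n.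
pose g n w := (expR (- (c w * n.+1%:R^-1)) * N w)%:E.
have mg n : measurable_fun [set: R] (g n).
  by rewrite /g /c; measurability.
have g0 n w : [set: R] w -> (0 <= g n w)%E.
  by move=> _; rewrite lee_fin mulr_ge0 ?expR_ge0.
have ndg w : [set: R] w -> nondecreasing_seq (g ^~ w).
  move=> _ m n mn; rewrite lee_fin ler_wpM2r// ler_expR lerN2 ler_wpM2l//.
  by rewrite lef_pV2 ?posrE// ler_nat.
have limg w : limn (g ^~ w) = (N w)%:E.
  apply/cvg_lim => //; apply: cvg_EFin; first exact: nearW.
  rewrite -[X in _ --> X]mul1r; apply: cvgM; last exact: cvg_cst.
  rewrite [X in _ --> X](_ : 1 = expR (- (c w * 0))); last first.
    by rewrite mulr0 oppr0 expR0.
  apply: continuous_cvg; first exact: continuous_expR.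
  by apply: cvgN; apply: cvgMr; exact: (@cvg_harmonic R).
have -> : (\int[mu]_w (N w)%:E = \int[mu]_w limn (g ^~ w))%E.
  by apply: eq_integral => w _; rewrite limg.
rewrite (monotone_convergence mu measurableT mg g0 ndg).
apply: lime_le.
  apply: ereal_nondecreasing_is_cvgn => m n mn.
  apply: ge0_le_integral; [by []|exact: g0|exact: mg|exact: mg|].
  by move=> w _; exact: ndg.
apply: nearW => n.
have t0 : 0 < n.+1%:R^-1 :> R by rewrite invr_gt0.
apply: (le_trans (saft_energy_heat t0)).
have H1 (x : R) : 0 <= cst (1 : R) x :> R by [].
have E1 (x : R) : cst (1 : R) x * cst (1 : R) x = 1 :> R by rewrite mulr1.
have m1 : measurable_fun [set: R] (cst (1 : R)) by [].
apply: (le_trans (schur_symmetric n.+1%:R^-1 mnf m1 m1 nf0 H1 H1 E1)).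
rewrite le_eqVlt; apply/orP; left; apply/eqP; apply: eq_integral => x _.
under eq_integral do rewrite mulr1.
by rewrite integral_heat// mule1 mulr1.
Qed.
(** The power identities hold only off the origin, where [powR] has its default value; this null
    point may be discarded. *)
Lemma ge0_integral_setT_D1 (g : R -> \bar R) : measurable_fun [set: R] g ->
  (\int[mu]_x g x = \int[mu]_(x in [set: R] `\ (0%R : R)) g x)%E.
Proof.
move=> mg; apply/esym; apply: integral_setD1; first exact: measurableD.
exact: measurable_funTS.
Qed.

(** The rate is the square of |w| / (2 |B|), so density parameter alpha / 2 produces the power -
    alpha of this quotient. This is the source of |B|^alpha on the left of the final inequality and
    of 2^(- alpha) in the sharp constant. *)
Lemma integral_powpos_gauss_norm (alpha w : R) : 0 < alpha -> alpha < 1 -> w != 0 ->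
  (\int[mu]_t ((powpos (alpha / 2) t)%:E *
     (expR (- (w ^+ 2 / (4 * B ^+ 2) * t)))%:E) =
   (Gamma (alpha / 2) * 2 `^ alpha * (`|B| `^ alpha * `|w| `^ (- alpha)))%:E)%E.
Proof.
move=> al0 al1 w0.
have a01 : 0 < alpha / 2 <= 1 by apply/andP; split; lra.
pose u := `|w| * (2 * `|B|) `^ (-1).
have B0 : 0 < `|B| by rewrite normr_gt0.
have w_gt0 : 0 < `|w| by rewrite normr_gt0.
have B20 : 0 < 2 * `|B| by rewrite mulr_gt0.
have u0 : 0 < u by rewrite mulr_gt0 ?powR_gt0.
have -> : w ^+ 2 / (4 * B ^+ 2) = u ^+ 2.
  rewrite /u (powR_inv1 (ltW B20)) exprMn exprVn exprMn !real_normK ?num_real//.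
  by congr (_ / (_ * _)); ring.
rewrite integral_powpos_expRM ?exprn_gt0//; congr (_%:E); rewrite -!mulrA.
congr (_ * _); rewrite -powR_mulrn ?(ltW u0)// -powRrM.
have -> : 2 * - (alpha / 2) = - alpha by field.
rewrite /u powRM ?powR_ge0 ?(ltW w_gt0)// -powRrM mulN1r opprK.
by rewrite powRM ?(ltW B0)// mulrC mulrA.
Qed.

Lemma saft_pitt (alpha : R) : 0 < alpha -> alpha < 1 ->
  ((`|B| `^ alpha)%:E * \int[mu]_w (`|w| `^ (- alpha) * N w)%:E <=
   (2 `^ (- alpha) *
     (Gamma ((1 - alpha) / 4) / Gamma ((1 + alpha) / 4)) ^+ 2)%:E *
   \int[mu]_x (`|x| `^ alpha * nf x ^+ 2)%:E)%E.
Proof.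
move=> al0 al1.
(* [a] belongs to the frequency weight, [c] to the Schur weight |y|^(2 c - 1). They satisfy a + c =
   1/2 - c and 1/2 - (a + c) = c. *)
pose a := alpha / 2; pose c := (1 - alpha) / 4.
have a0 : 0 < a by rewrite /a; lra.
have c0 : 0 < c by rewrite /c; lra.
have ac : a + c < 2^-1 by rewrite /a /c; lra.
have a01 : 0 < a <= 1 by apply/andP; split; lra.
have Ga0 := Gamma_gt0 a01.
pose K0 := 2 `^ (- alpha) / Gamma a.
have K00 : 0 < K0 by rewrite divr_gt0 ?powR_gt0.
pose e (w t : R) := expR (- (w ^+ 2 / (4 * B ^+ 2) * t)).
have me : measurable_fun [set: R * R] (fun z => e z.1 z.2).
  by rewrite /e; measurability.
have mew w : measurable_fun [set: R] (e w) by rewrite /e; measurability.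
have met t : measurable_fun [set: R] (e ^~ t) by rewrite /e; measurability.
pose G w t := ((powpos a t)%:E * (e w t * N w)%:E)%E.
have G0 w t : (0 <= G w t)%E.
  by rewrite mule_ge0// lee_fin ?powpos_ge0// mulr_ge0 ?expR_ge0.
have mG : measurable_fun [set: R * R] (fun z => G z.1 z.2).
  by rewrite /G; measurability.
have mGI : measurable_fun [set: R] (fun w => \int[mu]_t G w t)%E.
  exact: measurable_fun_ge0_integral.
(* [powR] gives 0 at the origin for either exponent; the indicator resets the value to 1 there, so
   that pf * qf = 1 everywhere. *)
pose pf (y : R) := `|y| `^ (2 * c - 1) + \1_[set (0 : R)] y.
pose qf (y : R) := `|y| `^ (1 - 2 * c) + \1_[set (0 : R)] y.
have m1 : measurable_fun [set: R] (\1_[set (0 : R)] : R -> R).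
  exact: measurable_indic.
have mpf : measurable_fun [set: R] pf by rewrite /pf; measurability.
have mqf : measurable_fun [set: R] qf by rewrite /qf; measurability.
have pf0 x : 0 <= pf x by rewrite addr_ge0 ?powR_ge0.
have qf0 x : 0 <= qf x by rewrite addr_ge0 ?powR_ge0.
have pfE x : x != 0 -> pf x = `|x| `^ (2 * c - 1).
  by move=> x0; rewrite /pf indicE memNset ?addr0//; exact/eqP.
have qfE x : x != 0 -> qf x = `|x| `^ (1 - 2 * c).
  by move=> x0; rewrite /qf indicE memNset ?addr0//; exact/eqP.
have pq x : pf x * qf x = 1.
  have [->|x0] := eqVneq x 0.
    rewrite /pf /qf indicE mem_set//= normr0 !powR0 ?add0r ?mulr1//; apply/eqP;
    by rewrite /c; lra.
  rewrite pfE// qfE// -powRD ?normr_eq0 ?x0 ?implybT//.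
  by rewrite (_ : _ + _ = 0) ?powRr0//; ring.
pose I (t x : R) := (\int[mu]_y (heat t (x - y) * pf y)%:E)%E.
have I0 t x : (0 <= I t x)%E.
  by apply: integral_ge0 => y _; rewrite lee_fin mulr_ge0 ?heat_ge0.
have mI : measurable_fun [set: R * R] (fun z => I z.1 z.2).
  apply: (@measurable_fun_ge0_integral _ _ _
    (fun (z : R * R) y => (heat z.1 (z.2 - y) * pf y)%:E)) => [|z y]; last first.
    by rewrite lee_fin mulr_ge0 ?heat_ge0.
  pose g1 (z : R * R * R) := z.1.1; pose g2 (z : R * R * R) := z.1.2.
  have mg1 : measurable_fun [set: R * R * R] g1.
    exact: (measurableT_comp measurable_fst measurable_fst).
  have mg2 : measurable_fun [set: R * R * R] g2.
    exact: (measurableT_comp measurable_snd measurable_fst).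
  change (measurable_fun [set: R * R * R]
    (fun z => (heat (g1 z) (g2 z - z.2) * pf z.2)%:E)).
  by measurability.
have mIt t : measurable_fun [set: R] (I t).
  exact: (measurableT_comp mI (measurable_pair1 t)).
have mIx x : measurable_fun [set: R] (I ^~ x).
  exact: (measurableT_comp mI (measurable_pair2 x)).
pose u x := nf x ^+ 2 * qf x.
have u0 x : 0 <= u x by rewrite mulr_ge0 ?sqr_ge0.
have mu_ : measurable_fun [set: R] u by rewrite /u; measurability.
pose C := Gamma a * Gamma c / Gamma (a + c) *
  (Gamma (2^-1 - (a + c)) / Gamma (2^-1 - c)).
have Ibound x : x != 0 -> (\int[mu]_t ((powpos a t)%:E * I t x) <=
    (C * `|x| `^ (2 * (a + c) - 1))%:E)%E.
  move=> x0; apply: le_trans (integral_heat_power_le a0 c0 ac x0).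
  rewrite le_eqVlt; apply/orP; left; apply/eqP.
  apply: eq_integral => t _; congr (_ * _)%E; rewrite /I.
  rewrite ge0_integral_setT_D1; last by measurability.
  rewrite [RHS]ge0_integral_setT_D1; last by measurability.
  apply: eq_integral => y; rewrite inE/= => -[_ /eqP y0].
  by rewrite pfE.
have step1 w : ((`|B| `^ alpha)%:E * (`|w| `^ (- alpha) * N w)%:E <=
    K0%:E * \int[mu]_t G w t)%E.
  (* At w = 0 the left-hand side vanishes by the default value of the power; elsewhere the two sides
     are equal. *)
  have [->|w0] := eqVneq w 0.
    rewrite normr0 powR0 ?mul0r ?mule0; last by rewrite oppr_eq0 gt_eqF.
    by rewrite mule_ge0// ?lee_fin ?(ltW K00)//; apply: integral_ge0.
  have -> : (\int[mu]_t G w t = (N w)%:E *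
      \int[mu]_t ((powpos a t)%:E * (e w t)%:E))%E.
    rewrite -ge0_integralMl.
    - by apply: eq_integral => t _; rewrite /G (EFinM (e w t)) muleA [RHS]muleC.
    - exact: N0.
    - by have m := mew w; measurability.
    - by move=> t; rewrite mule_ge0// lee_fin ?powpos_ge0 ?expR_ge0.
  rewrite integral_powpos_gauss_norm// -!EFinM lee_fin /K0 -/a.
  rewrite le_eqVlt; apply/orP; left; apply/eqP.
  have two0 : (2 : R) `^ alpha != 0 by rewrite gt_eqF ?powR_gt0.
  rewrite (powRN 2); move: (2 `^ alpha) two0 (Gamma a) Ga0 => T T0 g /lt0r_neq0 g0.
  by field; rewrite T0 g0.
have step2 t : (\int[mu]_w G w t <=
    (powpos a t)%:E * \int[mu]_x ((u x)%:E * I t x))%E.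
  have [t0|t0] := ltP 0 t; last first.
    rewrite (powpos_eq0 _ t0) mul0e integral0_eq// => w _.
    by rewrite /G (powpos_eq0 _ t0) mul0e.
  rewrite /G ge0_integralMl; last 3 first.
  - exact: powpos_ge0.
  - by have m := met t; measurability.
  - by move=> w; rewrite lee_fin mulr_ge0 ?expR_ge0.
  apply: lee_wpmul2l; first by rewrite lee_fin powpos_ge0.
  apply: (le_trans (saft_energy_heat t0)).
  exact: schur_symmetric.
have uI0 t x : (0 <= (powpos a t)%:E * ((u x)%:E * I t x))%E.
  by rewrite mule_ge0 ?lee_fin ?powpos_ge0// mule_ge0// lee_fin.
have muI : measurable_fun [set: R * R]
    (fun z => (powpos a z.1)%:E * ((u z.2)%:E * I z.1 z.2))%E.
  apply: emeasurable_funM; first by measurability.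
  by apply: emeasurable_funM; [measurability|exact: mI].
rewrite -ge0_integralMl; last 3 first.
- exact: powR_ge0.
- by measurability.
- by move=> w; rewrite lee_fin mulr_ge0 ?powR_ge0.
apply: (@le_trans _ _ (\int[mu]_w (K0%:E * \int[mu]_t G w t))%E).
  apply: ge0_le_integral; first by [].
  - move=> w _; rewrite mule_ge0// ?lee_fin ?powR_ge0//.
    by rewrite mulr_ge0 ?powR_ge0.
  - by measurability.
  - by apply: emeasurable_funM; [exact: measurable_cst|exact: mGI].
  - by move=> w _; exact: step1.
rewrite ge0_integralMl; last 3 first.
- exact: ltW.
- exact: mGI.
- by move=> w; apply: integral_ge0.
rewrite (@ge0_integral_swap _ G mG G0).
have step3 : (\int[mu]_t \int[mu]_w G w t <=
    \int[mu]_x (C * (`|x| `^ alpha * nf x ^+ 2))%:E)%E.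
  apply: (@le_trans _ _ (\int[mu]_t \int[mu]_x
      ((powpos a t)%:E * ((u x)%:E * I t x)))%E).
    apply: ge0_le_integral; first by [].
    - by move=> t _; apply: integral_ge0.
    - apply: (@measurable_fun_ge0_integral _ _ _ (fun t w => G w t)).
        by have := measurableT_comp mG (@measurable_swap _ _ _ _).
      by move=> t w; exact: G0.
    - exact: measurable_fun_ge0_integral.
    - move=> t _; rewrite ge0_integralMl; [exact: step2|exact: powpos_ge0| |].
        by apply: emeasurable_funM; [measurability|exact: mIt].
      by move=> x; rewrite mule_ge0// lee_fin.
  rewrite (@ge0_integral_swap _ (fun t x => (powpos a t)%:E * ((u x)%:E * I t x))%E
    muI uI0).
  have mL : measurable_fun [set: R]
      (fun x => \int[mu]_t ((powpos a t)%:E * ((u x)%:E * I t x)))%E.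
    apply: (@measurable_fun_ge0_integral _ _ _
      (fun x t => (powpos a t)%:E * ((u x)%:E * I t x))%E).
      by have := measurableT_comp muI (@measurable_swap _ _ _ _).
    by move=> x t; exact: uI0.
  have mRHS : measurable_fun [set: R] (fun x => (C * (`|x| `^ alpha * nf x ^+ 2))%:E).
    by measurability.
  rewrite ge0_integral_setT_D1// [leRHS]ge0_integral_setT_D1//.
  apply: ge0_le_integral.
  - exact: measurableD.
  - by move=> x _; apply: integral_ge0.
  - exact: measurable_funTS.
  - exact: measurable_funTS.
  move=> x [_ /eqP x0].
  have -> : (\int[mu]_t ((powpos a t)%:E * ((u x)%:E * I t x)) =
      (u x)%:E * \int[mu]_t ((powpos a t)%:E * I t x))%E.
    rewrite -ge0_integralMl; last 3 first.
    - exact: u0.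
    - by apply: emeasurable_funM; [measurability|exact: mIx].
    - by move=> t; rewrite mule_ge0// lee_fin powpos_ge0.
    by apply: eq_integral => t _; rewrite muleCA.
  apply: (le_trans (lee_wpmul2l _ (Ibound x x0))); first by rewrite lee_fin.
  rewrite -EFinM lee_fin /u qfE// le_eqVlt; apply/orP; left; apply/eqP.
  (* The exponent of [qf] and that of the potential add up to 2 a = alpha. *)
  have -> : `|x| `^ alpha = `|x| `^ (1 - 2 * c) * `|x| `^ (2 * (a + c) - 1).
    rewrite -powRD ?normr_eq0 ?x0 ?implybT//; congr powR.
    by rewrite /a; field.
  by ring.
apply: (le_trans (lee_wpmul2l _ step3)); first by rewrite lee_fin ltW.
have ac_gt0 : 0 < (1 + alpha) / 4 <= 1 by apply/andP; split; lra.
have Gac0 := Gamma_gt0 ac_gt0.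
have C0 : C = Gamma a * (Gamma ((1 - alpha) / 4) / Gamma ((1 + alpha) / 4)) ^+ 2.
  rewrite /C (_ : 2^-1 - (a + c) = (1 - alpha) / 4); last by rewrite /a /c; field.
  rewrite (_ : 2^-1 - c = (1 + alpha) / 4); last by rewrite /c; field.
  rewrite (_ : a + c = (1 + alpha) / 4); last by rewrite /a /c; field.
  move: (Gamma ((1 + alpha) / 4)) Gac0 => g /lt0r_neq0 g0.
  by rewrite /c; move: (Gamma ((1 - alpha) / 4)) (Gamma a) => g1 g2; field.
have KC : 2 `^ (- alpha) *
    (Gamma ((1 - alpha) / 4) / Gamma ((1 + alpha) / 4)) ^+ 2 = K0 * C.
  rewrite C0 /K0; move: (2 `^ _) (Gamma a) Ga0 (_ ^+ 2) => x g /lt0r_neq0 g0 y.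
  by field.
have C_ge0 : 0 <= C by rewrite C0; exact: (mulr_ge0 (ltW Ga0) (sqr_ge0 _)).
have -> : (\int[mu]_x (C * (`|x| `^ alpha * nf x ^+ 2))%:E =
    C%:E * \int[mu]_x (`|x| `^ alpha * nf x ^+ 2)%:E)%E.
  rewrite -ge0_integralMl; last 3 first.
  - exact: C_ge0.
  - by measurability.
  - by move=> x; rewrite lee_fin mulr_ge0 ?powR_ge0 ?sqr_ge0.
  by apply: eq_integral => x _; rewrite EFinM.
rewrite KC (EFinM K0 C) -(muleA K0%:E C%:E).
exact: lexx.
Qed.

End SaftPitt.

Theorem theorem4p2 (R : realType) (A B C D p q : R)
    (hdet : A * D - B * C = 1) (hB : B != 0)
    (alpha : R) (halpha0 : 0 <= alpha) (halpha1 : alpha < 1)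
    (f : R -> R[i]) (hf : schwartz f) :
  ((`|B| `^ alpha)%:E *
     \int[@lebesgue_measure R]_omega
       (`|omega| `^ (- alpha) * Normc.normc (saft A B D p q f omega) ^+ 2)%:E
   <= (pitt_const alpha)%:E *
     \int[@lebesgue_measure R]_x
       (`|x| `^ alpha * Normc.normc (f x) ^+ 2)%:E)%E.

Proof.
have [mRe mIm] := schwartz_measurable hf.
have If := schwartz_integrable hf.
(* At alpha = 0 the density parameter alpha / 2 of the superposition degenerates. Here the stated
   constant is 1, the quotient being Gamma (1/4) over itself. *)
have [->|alpha_neq0] := eqVneq alpha 0.
  have G1 : 0 < Gamma (1 / 4 : R) by apply: Gamma_gt0; lra.
  rewrite /pitt_const subr0 addr0 !powRr0 mulfV ?gt_eqF// expr1n mulr1 !mul1e.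
  under eq_integral do rewrite oppr0 powRr0 mul1r.
  under [leRHS]eq_integral do rewrite powRr0 mul1r.
  exact: saft_contraction.
have alpha_gt0 : 0 < alpha by rewrite lt_neqAle eq_sym alpha_neq0.
apply: (le_trans (saft_pitt A D p q hB mRe mIm If alpha_gt0 halpha1)).
apply: lee_wpmul2r.
  by apply: integral_ge0 => x _; rewrite lee_fin mulr_ge0 ?powR_ge0 ?sqr_ge0.
rewrite lee_fin /pitt_const ler_wpM2r ?sqr_ge0// powRN.
(* The sharp and the stated constants are separated by 2^(- alpha) <= 1 <= pi^alpha. *)
apply: (@le_trans _ _ 1).
  by rewrite invf_le1 ?powR_gt0// -[leLHS](powRr0 (2 : R)) ler_powR// ler1n.
by rewrite -[leLHS](powRr0 (pi : R)) ler_powR// (le_trans _ (pi_ge2 R))// ler1n.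
Qed.
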